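(* Let $\beta\in A[x]$ and let $f\in A_+$ be irreducible. Then $\mathcal{E}_\phi(\beta,z)=\exp_\phi(\mathcal{L}_\phi(\beta,z))\in A_{(f)}[x][[z]]$, where $A_{(f)}=\{g\in K:\operatorname{ord}_f(g)\ge0\}$.
   Context: $A=\mathbb{F}_q[\theta]$, $K=\mathbb{F}_q(\theta)$, $A_+$ the monic polynomials, $\deg=\deg_\theta$. $\phi$ is a Drinfeld module of rank $r\ge1$ with $\phi_\theta=\theta+\kappa_1\tau+\dots+\kappa_r\tau^r$, $\kappa_i\in A$, $\kappa_r\ne0$, $\tau$ the $q$-th power Frobenius; $\exp_\phi(z)=\sum_{i\ge0}\alpha_iz^{q^i}\in K[[z]]$, $\alpha_0=1$, satisfies $\exp_\phi(az)=\phi_a(\exp_\phi(z))$ for all $a\in A$. The Carlitz module is $C_\theta=\theta+\tau$; for $a\in A$, $\beta\in K[x]$, $(a\star\beta)(x)=\beta(C_a(x))$. For irreducible monic $g$ of degree $d$, let $r_0$ be the rank of the reduction of $\phi$ mod $g$; if $r_0\ge1$ let $P_g(x)=x^{r_0}+a_{r_0-1}x^{r_0-1}+\dots+a_0$ be the characteristic polynomial of $\tau^d$ on the $\lambda$-adic Tate module of the reduction ($\lambda\ne g$), with $a_0=c_g^{-1}g$, $c_g\in\mathbb{F}_q^\times$; set $b_\ell=-c_ga_\ell$ ($1\le\ell\le r_0-1$), $b_{r_0}=-c_g$, $b_\ell=0$ for $\ell>r_0$ (all zero if $r_0=0$), $R_g(x)=1-b_1x-b_2gx^2-\dots-b_rg^{r-1}x^r$.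 $\mu:A_+\to A$ is multiplicative with $\sum_{m\ge0}\mu(g^m)x^m=R_g(x)^{-1}$. Finally $\mathcal{L}_\phi(\beta,z)=\sum_{a\in A_+}\frac{\mu(a)(a\star\beta)(x)}{a}z^{q^{\deg a}}\in K[x][[z]]$. *)

(* Defs.v *)
From HB Require Import structures.
From mathcomp Require Import all_boot all_order all_algebra all_field.
From mathcomp Require Import boolp.

Set Implicit Arguments.
Unset Strict Implicit.
Unset Printing Implicit Defensive.

Import Order.TTheory GRing.Theory Num.Theory.
Local Open Scope ring_scope.

(* Throughout, F is the field F_q with q = #|F|, A = F_q[theta] is {poly F}
   (so 'X : {poly F} is theta), and K = F_q(theta) is {fraction {poly F}}. *)

(* Formal power series over R are coefficient functions nat -> R. *)

Section PowerSeries.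
Variable R : comNzRingType.

(* The composite u(v(z)), meaningful only when v has no constant term: the
   coefficient of z^n then depends only on the truncations of u and v modulo
   z^(n+1). *)
Definition ps_comp (u v : nat -> R) (n : nat) : R :=
  ((\poly_(i < n.+1) u i) \Po (\poly_(i < n.+1) v i))`_n.

(* sum_i c_i z^(q^i); the bound i <= n loses nothing since i < q^i. *)
Definition ps_frob (q : nat) (c : nat -> R) (n : nat) : R :=
  \sum_(i < n.+1 | n == (q ^ i)%N) c i.

End PowerSeries.

(* The lambda-adic completion A_lambda = lim_n A/(lambda^n) at a monic
   irreducible lambda, the class modulo lambda^n being represented by its
   remainder. *)

Section Adic.
Variables (F : fieldType) (l : {poly F}) (hl : monic_irreducible_poly l).

Record adic_seq := AdicSeq {
  adic_val :> nat -> {poly F};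
  adic_valP : forall n, adic_val n = adic_val n.+1 %% l ^+ n
}.

Definition adic of monic_irreducible_poly l : Type := adic_seq.
Local Notation Al := (adic hl).

HB.instance Definition _ := gen_eqMixin Al.
HB.instance Definition _ := gen_choiceMixin Al.

Lemma adic_eq (x y : Al) : (forall n, adic_val x n = adic_val y n) -> x = y.
Proof.
case: x y => [x hx] [y hy] /= /funext xy; subst y.
by congr AdicSeq; exact: Prop_irrelevance.
Qed.

Lemma adic_mod (x : Al) n : adic_val x n %% l ^+ n = adic_val x n.
Proof. by rewrite (adic_valP x) modp_id. Qed.

Lemma modp_expS (p : {poly F}) n : (p %% l ^+ n.+1) %% l ^+ n = p %% l ^+ n.
Proof.
rewrite [in RHS](divp_eq p (l ^+ n.+1)) modpD [in _ * l ^+ _]exprS mulrA.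
by rewrite modp_mull add0r.
Qed.

Definition adic_of (p : {poly F}) : Al :=
  @AdicSeq (fun n => p %% l ^+ n) (fun n => esym (modp_expS p n)).

Lemma adic_addP (x y : Al) n :
  adic_val x n + adic_val y n
  = (adic_val x n.+1 + adic_val y n.+1) %% l ^+ n.
Proof. by rewrite modpD -!adic_valP. Qed.
Definition adic_add (x y : Al) : Al := AdicSeq (adic_addP x y).

Lemma adic_oppP (x : Al) n : - adic_val x n = (- adic_val x n.+1) %% l ^+ n.
Proof. by rewrite modpN -adic_valP. Qed.
Definition adic_opp (x : Al) : Al := AdicSeq (adic_oppP x).

Lemma adic_mulP (x y : Al) n :
  (adic_val x n * adic_val y n) %% l ^+ n
  = ((adic_val x n.+1 * adic_val y n.+1) %% l ^+ n.+1) %% l ^+ n.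
Proof.
rewrite modp_expS [in LHS](adic_valP x) [in LHS](adic_valP y).
by rewrite modp_mul mulrC modp_mul mulrC.
Qed.
Definition adic_mul (x y : Al) : Al := AdicSeq (adic_mulP x y).

Lemma adic_addA : associative adic_add.
Proof. by move=> x y z; apply: adic_eq => n /=; rewrite addrA. Qed.
Lemma adic_addC : commutative adic_add.
Proof. by move=> x y; apply: adic_eq => n /=; rewrite addrC. Qed.
Lemma adic_add0 : left_id (adic_of 0) adic_add.
Proof. by move=> x; apply: adic_eq => n /=; rewrite mod0p add0r. Qed.
Lemma adic_addN : left_inverse (adic_of 0) adic_opp adic_add.
Proof. by move=> x; apply: adic_eq => n /=; rewrite mod0p addNr. Qed.
HB.instance Definition _ :=
  GRing.isZmodule.Build Al adic_addA adic_addC adic_add0 adic_addN.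

Lemma adic_mulA : associative adic_mul.
Proof.
move=> x y z; apply: adic_eq => n /=.
by rewrite modp_mul mulrA [in RHS]mulrC modp_mul [in RHS]mulrC.
Qed.
Lemma adic_mulC : commutative adic_mul.
Proof. by move=> x y; apply: adic_eq => n /=; rewrite mulrC. Qed.
Lemma adic_mul1 : left_id (adic_of 1) adic_mul.
Proof.
by move=> x; apply: adic_eq => n /=; rewrite mulrC modp_mul mulr1 adic_mod.
Qed.
Lemma adic_mulD : left_distributive adic_mul adic_add.
Proof. by move=> x y z; apply: adic_eq => n /=; rewrite mulrDl modpD. Qed.
Lemma adic_1neq0 : adic_of 1 != 0.
Proof.
apply/eqP => /(congr1 (fun x : Al => adic_val x 1%N)) /=.
rewrite expr1 mod0p modp_small ?size_poly1 ?hl.1 // => /eqP.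
by rewrite oner_eq0.
Qed.
HB.instance Definition _ :=
  GRing.Zmodule_isComNzRing.Build Al
    adic_mulA adic_mulC adic_mul1 adic_mulD adic_1neq0.

Lemma adic_of_is_zmod_morphism : zmod_morphism adic_of.
Proof. by move=> p p'; apply: adic_eq => n /=; rewrite modpD modpN. Qed.
Lemma adic_of_is_monoid_morphism : monoid_morphism adic_of.
Proof.
split=> // p p'; apply: adic_eq => n /=.
by rewrite modp_mul [in RHS]mulrC modp_mul mulrC.
Qed.
HB.instance Definition _ :=
  GRing.isZmodMorphism.Build {poly F} Al adic_of adic_of_is_zmod_morphism.
HB.instance Definition _ :=
  GRing.isMonoidMorphism.Build {poly F} Al adic_of adic_of_is_monoid_morphism.

End Adic.

(* A Drinfeld module over A, given by the coefficients of phi_theta: the entry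
   of index i of dm_coef is the coefficient of tau^i, so index 0 holds theta
   and index i >= 1 holds kappa_i. *)
Record drinfeld (F : finFieldType) := Drinfeld {
  dm_coef :> {poly {poly F}};
  dm_coef0 : dm_coef`_0 = 'X;
  dm_rank_gt0 : (1 < size dm_coef)%N
}.

Definition dm_rank (F : finFieldType) (phi : drinfeld F) : nat :=
  (size phi).-1.

Section Carlitz.
Variable F : finFieldType.

(* C_theta = theta + tau; the outer variable 'X is tau. *)
Definition carlitz_coef : {poly {poly F}} := ('X : {poly F})%:P + 'X.

Lemma carlitz_coef0 : carlitz_coef`_0 = 'X.
Proof. by rewrite coefD coefX coefC addr0. Qed.
Lemma carlitz_rank_gt0 : (1 < size carlitz_coef)%N.
Proof. by rewrite /carlitz_coef addrC size_XaddC. Qed.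
Definition carlitz : drinfeld F := Drinfeld carlitz_coef0 carlitz_rank_gt0.

End Carlitz.

(* For an A-algebra iota : A -> R, phi_theta and phi_a as the F_q-linear
   polynomials phi_theta(X) and phi_a(X) of R[X]. Since phi is F_q-linear and
   multiplicative, phi_a is the sum over j of a_j times the j-th compositional
   power of phi_theta. *)
Section PhiPoly.
Variables (F : finFieldType) (R : comNzRingType) (iota : {poly F} -> R).

Definition phi_theta (phi : drinfeld F) : {poly R} :=
  \sum_(i < size phi) iota phi`_i *: 'X^(#|F| ^ i).

Definition phi_poly (phi : drinfeld F) (a : {poly F}) : {poly R} :=
  \sum_(j < size a)
    iota (a`_j)%:P *: iter j (fun p => phi_theta phi \Po p) 'X.

End PhiPoly.

Section Exponential.
Variable F : finFieldType.
Local Notation K := {fraction {poly F}}.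

(* exp_phi(z) = sum_i alpha_i z^(q^i), with alpha_0 = 1 and
   exp_phi(a z) = phi_a(exp_phi(z)) coefficientwise. *)
Definition exp_series (alpha : nat -> K) : nat -> K := ps_frob #|F| alpha.

Definition is_drinfeld_exp (phi : drinfeld F) (alpha : nat -> K) : Prop :=
  alpha 0%N = 1 /\
  forall (a : {poly F}) (n : nat),
    tofrac a ^+ n * exp_series alpha n
    = ps_comp (fun i => (phi_poly (@tofrac _) phi a)`_i) (exp_series alpha) n.

End Exponential.

Section Reduction.
Variables (F : finFieldType) (g : {poly F}) (hg : monic_irreducible_poly g).

Definition residue_closure : countClosedFieldType :=
  projT1 (countable_algebraic_closure {poly %/ g with hg}).

Definition reduce (a : {poly F}) : residue_closure :=
  sval (projT2 (countable_algebraic_closure {poly %/ g with hg}))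
    (in_qpoly g a).

Local Notation kbar := residue_closure.

(* The action of a in A on kbar through the reduction of phi modulo g. *)
Definition red_act (phi : drinfeld F) (a : {poly F}) (y : kbar) : kbar :=
  (phi_poly reduce phi a).[y].

Section Tate.
Variables (phi : drinfeld F) (l : {poly F}) (hl : monic_irreducible_poly l).

(* The l-adic Tate module lim_n phibar[l^n], the transition maps being the
   action of l: x n lies in phibar[l^n]. *)
Definition in_tate (x : nat -> kbar) : Prop :=
  x 0%N = 0 /\ forall n, red_act phi l (x n.+1) = x n.

(* The linear combination sum_i c_i e_i, a scalar of A_l acting on level n
   through its class modulo l^n. *)
Definition tate_comb r0 (e : 'I_r0 -> nat -> kbar) (c : 'I_r0 -> adic hl)
    (n : nat) : kbar :=
  \sum_i red_act phi (adic_val (c i) n) (e i n).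

Definition tate_basis r0 (e : 'I_r0 -> nat -> kbar) : Prop :=
  (forall i, in_tate (e i)) /\
  forall x, in_tate x ->
    exists! c : {ffun 'I_r0 -> adic hl}, forall n, x n = tate_comb e c n.

(* tau^d acts on points as y |-> y^(q^d), where d = deg g. *)
Definition frob_mx r0 (e : 'I_r0 -> nat -> kbar) (M : 'M[adic hl]_r0) : Prop :=
  forall j n, e j n ^+ (#|F| ^ (size g).-1)
              = tate_comb e (fun i => M i j) n.

(* P is the characteristic polynomial of tau^d on a Tate module that is free
   of rank r0 over A_l. *)
Definition frob_char_poly (r0 : nat) (P : {poly {poly F}}) : Prop :=
  exists (e : 'I_r0 -> nat -> kbar) (M : 'M[adic hl]_r0),
    [/\ tate_basis e, frob_mx e M & map_poly (adic_of hl) P = char_poly M].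

End Tate.
End Reduction.

Section LocalFactors.
Variables (F : finFieldType) (phi : drinfeld F).

(* The rank r0 of the reduction of phi modulo g, i.e. its degree in tau. *)
Definition red_rank (g : {poly F}) : nat :=
  (size (map_poly (in_qpoly g) phi)).-1.

(* P g and c g are the characteristic polynomial P_g and the unit c_g, for
   every monic irreducible g at which the reduction has positive rank. *)
Definition frob_data (P : {poly F} -> {poly {poly F}}) (c : {poly F} -> F) :
    Prop :=
  forall (g : {poly F}) (hg : monic_irreducible_poly g),
    (0 < red_rank g)%N ->
    (exists (l : {poly F}) (hl : monic_irreducible_poly l),
       l <> g /\ frob_char_poly hg phi hl (red_rank g) (P g)) /\
    c g != 0 /\ (P g)`_0 = (c g)^-1 *: g.

Variables (P : {poly F} -> {poly {poly F}}) (c : {poly F} -> F).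

(* b_l, used for l >= 1 only. *)
Definition b_coef (g : {poly F}) (l : nat) : {poly F} :=
  if (l < red_rank g)%N then - (c g *: (P g)`_l)
  else if (l == red_rank g) && (0 < red_rank g)%N then - (c g)%:P
  else 0.

Definition R_poly (g : {poly F}) : {poly {poly F}} :=
  1 - \sum_(1 <= l < (dm_rank phi).+1) (b_coef g l * g ^+ l.-1) *: 'X^l.

(* mu : A_+ -> A is multiplicative and sum_m mu(g^m) x^m is the inverse of
   R_g(x) in A[[x]]; the values of mu off A_+ are irrelevant. *)
Definition is_mu (mu : {poly F} -> {poly F}) : Prop :=
  [/\ mu 1 = 1,
      forall a b, a \is monic -> b \is monic -> coprimep a b ->
        mu (a * b) = mu a * mu b &
      forall g, monic_irreducible_poly g -> forall n : nat,
        \sum_(i < n.+1) (R_poly g)`_i * mu (g ^+ (n - i)) = (n == 0%N)%:R].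

End LocalFactors.

Section LogAlgebraicity.
Variable F : finFieldType.
Local Notation A := {poly F}.
Local Notation K := {fraction {poly F}}.

(* (a * beta)(x) = beta(C_a(x)) *)
Definition star (a : A) (beta : {poly K}) : {poly K} :=
  beta \Po phi_poly (@tofrac _) (carlitz F) a.

(* The coefficient of z^(q^j): the sum over the monic a of degree j. *)
Definition L_coef (mu : A -> A) (beta : {poly K}) (j : nat) : {poly K} :=
  \sum_(a : {poly_(j.+1) F} | ((a : A) \is monic) && (size a == j.+1))
    (tofrac (mu a) / tofrac (a : A)) *: star a beta.

Definition L_series (mu : A -> A) (beta : {poly K}) : nat -> {poly K} :=
  ps_frob #|F| (L_coef mu beta).

Definition E_series (alpha : nat -> K) (mu : A -> A) (beta : {poly K}) :
    nat -> {poly K} :=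
  ps_comp (fun n => (exp_series alpha n)%:P) (L_series mu beta).

(* The largest m with f^m dividing p, for p <> 0 and f of positive degree;
   m < size p since deg (f^m) >= m. *)
Definition ord_poly (f p : A) : nat :=
  \max_(m < size p | f ^+ m %| p) m.

(* ord_f on K; the value at 0 (where ord_f = +oo) is not meaningful. *)
Definition ord_frac (f : A) (x : K) : int :=
  (ord_poly f (\n_(repr x)))%:Z - (ord_poly f (\d_(repr x)))%:Z.

Definition loc_ring (f : A) : {pred K} :=
  fun x => (x == 0) || (0 <= ord_frac f x).

End LogAlgebraicity.

(* Main.v *)
Require Import Defs.
From HB Require Import structures.
From mathcomp Require Import all_boot all_order all_algebra all_field.
From mathcomp Require Import abelian ring boolp.

(* Let L = L_phi(beta, z), E = exp_phi(L), d = deg f, and let sigma be the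
   K-linear substitution x |-> C_f(x).  The Euler factor of mu at f gives
       f L - sum_l b_l sigma^l(L) tau^(dl) = f H,
   where H is the part of the series indexed by the a prime to f, hence is
   f-integral.  Multiplying by exp_phi on the left, in the ring of twisted
   power series in tau over K[x], yields
       phi_f E - sum_l phi_(b_l) sigma^l(E) tau^(dl) = exp_phi f H,
   which is divisible by f because f^(q^i - 1) alpha_i is f-integral.  On the
   other hand sigma is congruent to tau^d modulo f, because
   C_f = x^(q^d) modulo f, and phi_f = sum_l phi_(b_l) tau^(dl) modulo f, by the
   Cayley-Hamilton theorem for the Frobenius on the Tate module.  Comparing the
   coefficients of tau^k shows, by induction on k, that f E_k is divisible by f,
   where E_k is the k-th coefficient of E. *)

Set Implicit Arguments.
Unset Strict Implicit.
Unset Printing Implicit Defensive.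

Import Order.TTheory GRing.Theory Num.Theory.
Local Open Scope ring_scope.

(** * Twisted power series *)

Section FrobeniusPower.
Variables (R : comNzRingType) (q : nat) (hq : [pchar R].-nat q).

Lemma pnat_charX i : [pchar R].-nat (q ^ i)%N.
Proof. by rewrite pnatX hq. Qed.

Lemma frobD i (x y : R) : (x + y) ^+ (q ^ i) = x ^+ (q ^ i) + y ^+ (q ^ i).
Proof. exact: exprDn_pchar (pnat_charX i). Qed.

Lemma frob_gt0 i : (0 < q ^ i)%N.
Proof. by case/andP: (pnat_charX i). Qed.

Lemma frob0 i : (0 : R) ^+ (q ^ i) = 0.
Proof. by rewrite expr0n gtn_eqF ?frob_gt0. Qed.

Lemma frob_sum i (I : Type) (r : seq I) (Q : pred I) (G : I -> R) :
  (\sum_(j <- r | Q j) G j) ^+ (q ^ i) = \sum_(j <- r | Q j) G j ^+ (q ^ i).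
Proof. by elim/big_rec2: _ => [|j y x _ <-]; rewrite ?frob0 ?frobD. Qed.

Lemma frobN i (x : R) : (- x) ^+ (q ^ i) = - x ^+ (q ^ i).
Proof. exact: exprNn_pchar (pnat_charX i). Qed.

End FrobeniusPower.

Lemma pnat_rmorph (R S : comNzRingType) (h : {rmorphism R -> S}) n :
  [pchar R].-nat n -> [pchar S].-nat n.
Proof. by apply: sub_in_pnat => p _; apply: rmorph_pchar. Qed.

(* The ring R{{tau}} of twisted power series sum_i u_i tau^i, with
   tau a = a^q tau. *)
Definition tser (R : comNzRingType) (q : nat) of [pchar R].-nat q : Type :=
  nat -> R.

Section TwistedSeries.
Variables (R : comNzRingType) (q : nat) (hq : [pchar R].-nat q).
Local Notation T := (tser hq).

HB.instance Definition _ := gen_eqMixin T.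
HB.instance Definition _ := gen_choiceMixin T.

Definition tser_add (u v : T) : T := fun n => u n + v n.
Definition tser_opp (u : T) : T := fun n => - u n.
Definition tser_mul (u v : T) : T :=
  fun n => \sum_(i < n.+1) u i * v (n - i)%N ^+ (q ^ i).
Definition tserC (x : R) : T := fun n => if n == 0%N then x else 0.

Lemma tser_addA : associative tser_add.
Proof. by move=> u v w; apply: funext => n; rewrite /tser_add addrA. Qed.
Lemma tser_addC : commutative tser_add.
Proof. by move=> u v; apply: funext => n; rewrite /tser_add addrC. Qed.
Lemma tser_add0 : left_id (tserC 0) tser_add.
Proof.
by move=> u; apply: funext => n; rewrite /tser_add /tserC if_same add0r.
Qed.
Lemma tser_addN : left_inverse (tserC 0) tser_opp tser_add.
Proof.
by move=> u; apply: funext => n; rewrite /tser_add /tserC if_same addNr.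
Qed.
HB.instance Definition _ :=
  GRing.isZmodule.Build T tser_addA tser_addC tser_add0 tser_addN.

Lemma sum_ord_shift (G : nat -> R) i n : (i <= n)%N ->
  \sum_(j < n.+1 | (i <= j)%N) G j = \sum_(j < (n - i).+1) G (i + j)%N.
Proof.
move=> ni; rewrite -(big_mkord (fun j => i <= j)%N G).
rewrite -(big_mkord xpredT (fun j => G (i + j)%N)).
rewrite (big_cat_nat (n := i)) ?leqW //= [X in X + _]big_nat_cond.
rewrite [X in X + _]big_pred0 ?add0r => [|j]; last by rewrite andbC leqNgt; case: ltnP.
rewrite -subSn // -[X in index_iota X]add0n big_addn.
by apply: eq_big => j => [|_]; rewrite ?leq_addl // addnC.
Qed.

Lemma tser_mulA : associative tser_mul.
Proof.
move=> u v w; apply: funext => n; rewrite /tser_mul.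
(* Both bracketings equal the sum of $u_i v_{j-i}^{q^i} w_{n-j}^{q^j}$ over $i\le j\le n$;
   additivity of the $q^i$-th power expands the inner product. *)
transitivity (\sum_(i < n.+1) \sum_(j < n.+1 | (i <= j)%N)
   u i * (v (j - i)%N ^+ (q ^ i) * w (n - j)%N ^+ (q ^ j))).
  apply: eq_bigr => i _; rewrite (frob_sum hq) big_distrr /=.
  rewrite (sum_ord_shift (fun j =>
    u i * (v (j - i)%N ^+ (q ^ i) * w (n - j)%N ^+ (q ^ j)))) -1?ltnS //.
  apply: eq_bigr => j _.
  by rewrite addKn exprMn -exprM mulnC -expnD subnDA.
rewrite (exchange_big_dep xpredT) //=; apply: eq_bigr => j _.
rewrite big_distrl /=.
rewrite (big_ord_narrow_leq (ltn_ord j : j <= n)%N).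
by apply: eq_bigr => i _; rewrite mulrA.
Qed.

Lemma tser_mul1 : left_id (tserC 1) tser_mul.
Proof.
move=> u; apply: funext => n; rewrite /tser_mul big_ord_recl subn0 expr1 mul1r.
by rewrite big1 ?addr0 // => i _; rewrite mul0r.
Qed.

Lemma tser_mulC (u : T) x n : tser_mul u (tserC x) n = u n * x ^+ (q ^ n).
Proof.
rewrite /tser_mul big_ord_recr /= subnn /tserC eqxx big1 ?add0r // => i _.
by rewrite subn_eq0 leqNgt ltn_ord (frob0 hq) mulr0.
Qed.

Lemma tser_mul1r : right_id (tserC 1) tser_mul.
Proof.
by move=> u; apply: funext => n; rewrite tser_mulC expr1n mulr1.
Qed.

Lemma tser_mulDl : left_distributive tser_mul tser_add.
Proof.
move=> u v w; apply: funext => n; rewrite /tser_mul /tser_add -big_split /=.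
by apply: eq_bigr => i _; rewrite mulrDl.
Qed.

Lemma tser_mulDr : right_distributive tser_mul tser_add.
Proof.
move=> u v w; apply: funext => n; rewrite /tser_mul /tser_add -big_split /=.
by apply: eq_bigr => i _; rewrite (frobD hq) mulrDr.
Qed.

Lemma tser_1neq0 : tserC 1 != 0.
Proof.
by apply/eqP => /(congr1 (fun u : T => u 0%N)) /eqP; rewrite oner_eq0.
Qed.

HB.instance Definition _ :=
  GRing.Zmodule_isNzRing.Build T
    tser_mulA tser_mul1 tser_mul1r tser_mulDl tser_mulDr tser_1neq0.

Lemma tserD (u v : T) n : (u + v) n = u n + v n. Proof. by []. Qed.
Lemma tserN (u : T) n : (- u) n = - u n. Proof. by []. Qed.
Lemma tser0 n : (0 : T) n = 0. Proof. by case: n. Qed.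
Lemma tserM (u v : T) n :
  (u * v) n = \sum_(i < n.+1) u i * v (n - i)%N ^+ (q ^ i).
Proof. by []. Qed.
Lemma tserMC (u : T) x n : (u * tserC x) n = u n * x ^+ (q ^ n).
Proof. exact: tser_mulC. Qed.
Lemma tserCM (u : T) x n : (tserC x * u) n = x * u n.
Proof.
rewrite tserM big_ord_recl subn0 expr1 big1 ?addr0 // => i _.
by rewrite mul0r.
Qed.
Lemma tser_sum (I : Type) (r : seq I) (Q : pred I) (G : I -> T) n :
  (\sum_(j <- r | Q j) G j) n = \sum_(j <- r | Q j) G j n.
Proof. by elim/big_rec2: _ => [|j y x _ <-]; rewrite ?tser0. Qed.

Lemma tserC_is_zmod_morphism : zmod_morphism tserC.
Proof.
move=> x y; apply: funext => n; rewrite tserD tserN /tserC.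
by case: eqP; rewrite ?subr0.
Qed.
Lemma tserC_is_monoid_morphism : monoid_morphism tserC.
Proof.
split=> // x y; apply: funext => n; rewrite tserCM /tserC.
by case: eqP; rewrite ?mulr0.
Qed.
HB.instance Definition _ :=
  GRing.isZmodMorphism.Build R T tserC tserC_is_zmod_morphism.
HB.instance Definition _ :=
  GRing.isMonoidMorphism.Build R T tserC tserC_is_monoid_morphism.

(* tau^m *)
Definition tserX m : T := fun n => (n == m)%:R.

Lemma tserXM m (u : T) n :
  (tserX m * u) n = if (m <= n)%N then u (n - m)%N ^+ (q ^ m) else 0.
Proof.
rewrite tserM; under eq_bigr => i _ do rewrite /tserX mulr_natl mulrb.
case: ifP => mn.
  rewrite (bigD1 (Ordinal (mn : m < n.+1)%N)) //= eqxx big1 ?addr0 //.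
  by move=> i /negbTE; rewrite -val_eqE /= => ->.
rewrite big1 // => i _; case: eqP => // im.
by rewrite -im -ltnS ltn_ord in mn.
Qed.

Lemma tserMX m (u : T) n :
  (u * tserX m) n = if (m <= n)%N then u (n - m)%N else 0.
Proof.
rewrite tserM; case: ifP => mn.
  have nm : (n - m < n.+1)%N by rewrite ltnS leq_subr.
  rewrite (bigD1 (Ordinal nm)) //= subKn // /tserX eqxx expr1n mulr1.
  rewrite big1 ?addr0 // => i; rewrite -val_eqE /= => hi.
  rewrite [X in _ * X ^+ _](_ : _ = 0) ?(frob0 hq) ?mulr0 //.
  case: eqP => // h; case/eqP: hi; rewrite -h subKn //.
  by rewrite -ltnS ltn_ord.
rewrite big1 // => i _.
rewrite /tserX; case: eqP => [h|_]; first by rewrite -h leq_subr in mn.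
by rewrite (frob0 hq) mulr0.
Qed.

End TwistedSeries.

Section TwistedMap.
Variables (R S : comNzRingType) (q : nat) (h : {rmorphism R -> S}).
Variables (hq : [pchar R].-nat q) (hq' : [pchar S].-nat q).

Definition tmap (u : tser hq) : tser hq' := fun n => h (u n).

Lemma tmap_is_zmod_morphism : zmod_morphism tmap.
Proof. by move=> u v; apply: funext => n; rewrite /tmap rmorphB. Qed.
Lemma tmap_is_monoid_morphism : monoid_morphism tmap.
Proof.
split=> [|u v]; apply: funext => n.
  by rewrite /tmap /GRing.one /= /tserC; case: eqP; rewrite (rmorph0, rmorph1).
rewrite /tmap !tserM rmorph_sum; apply: eq_bigr => i _.
by rewrite rmorphM rmorphXn.
Qed.
HB.instance Definition _ :=
  GRing.isZmodMorphism.Build _ _ tmap tmap_is_zmod_morphism.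
HB.instance Definition _ :=
  GRing.isMonoidMorphism.Build _ _ tmap tmap_is_monoid_morphism.

Lemma tmapC x : tmap (tserC hq x) = tserC hq' (h x).
Proof. by apply: funext => n; rewrite /tmap /tserC; case: eqP; rewrite ?rmorph0. Qed.
Lemma tmapX m : tmap (tserX hq m) = tserX hq' m.
Proof. by apply: funext => n; rewrite /tmap /tserX rmorph_nat. Qed.

End TwistedMap.

(** * Composition of $\mathbb{F}_q$-linear power series *)

Section FrobeniusSeries.
Variables (R : comNzRingType) (q : nat) (hq : [pchar R].-nat q).
Hypothesis q_gt1 : (1 < q)%N.
Local Notation T := (tser hq).

Lemma ps_frob_expn (u : nat -> R) k : ps_frob q u (q ^ k) = u k.
Proof.
have hk : (k < (q ^ k).+1)%N by rewrite ltnS ltnW // ltn_expl.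
rewrite /ps_frob (bigD1 (Ordinal hk)) //= big1 ?addr0 // => i /andP[/eqP].
by move/(expnI q_gt1) => ki; rewrite -val_eqE /= -ki eqxx.
Qed.

Lemma ps_frob_eq0 (u : nat -> R) n :
  (forall k, n <> (q ^ k)%N) -> ps_frob q u n = 0.
Proof. by move=> hn; rewrite /ps_frob big1 // => i /eqP /hn. Qed.

(** Raising to the power $q^s$ is additive on polynomials, so each monomial is raised separately and
    only exponents divisible by $q^s$ survive. *)
Lemma coef_exp_frob (p : {poly R}) s n :
  (p ^+ (q ^ s))`_n =
  if (q ^ s %| n)%N then p`_(n %/ q ^ s) ^+ (q ^ s) else 0.
Proof.
have hq' : [pchar {poly R}].-nat q := pnat_rmorph polyC hq.
have qs := frob_gt0 hq s.
rewrite -[p in LHS]coefK poly_def (frob_sum hq') coef_sum.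
under eq_bigr => i _ do
  rewrite -mul_polyC exprMn -polyC_exp -exprM coefCM coefXn.
case: ifP => [/dvdnP[k ->]|hn].
  rewrite mulnK //; have [ks|ks] := ltnP k (size p).
    rewrite (bigD1 (Ordinal ks)) //= eqxx mulr1 big1 ?addr0 // => i.
    by rewrite -val_eqE eqn_pmul2r //= eq_sym => /negbTE->; rewrite mulr0.
  rewrite nth_default // (frob0 hq) big1 // => i _.
  rewrite eqn_pmul2r // gtn_eqF ?mulr0 //; exact: leq_trans (ltn_ord i) ks.
rewrite big1 // => i _; case: eqP; rewrite ?mulr0 // => h.
by rewrite h dvdn_mull in hn.
Qed.

(* Composition of F_q-linear series is the product of R{{tau}}. *)
Lemma coef_comp_frob (p r : {poly R}) (u v : T) n :
  (forall m, (m <= n)%N -> p`_m = ps_frob q u m) ->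
  (forall m, (m <= n)%N -> r`_m = ps_frob q v m) ->
  (p \Po r)`_n = ps_frob q (u * v) n.
Proof.
move=> hp hr.
(* Since 0 is not a power of $q$, [r] has no constant term. So [r ^+ i] starts in degree at least
   [i], and the terms with [i > n] drop out. *)
have r0 : r`_0 = 0.
  rewrite hr // ps_frob_eq0 // => k /eqP.
  by rewrite eq_sym expn_eq0 gtn_eqF // ltnW.
have rX i : (n < i)%N -> (r ^+ i)`_n = 0.
  have /factor_theorem[r' ->] : root r 0 by rewrite /root horner_coef0 r0.
  by move=> ni; rewrite subr0 exprMn mulrC coefXnM ni.
rewrite coef_comp_poly.
transitivity (\sum_(i < n.+1) p`_i * (r ^+ i)`_n).
  rewrite -(big_mkord xpredT (fun i => p`_i * (r ^+ i)`_n)).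
  rewrite -(big_mkord xpredT (fun i => p`_i * (r ^+ i)`_n)).
  have [sn|ns] := leqP (size p) n.+1.
    rewrite [RHS](big_cat_nat (n := size p)) //=.
    rewrite [X in _ = _ + X]big_nat_cond [X in _ = _ + X]big1 ?addr0 // => i.
    by rewrite andbT => /andP[si _]; rewrite nth_default ?mul0r.
  rewrite (big_cat_nat (n := n.+1)) //=; last exact: ltnW.
  rewrite [X in _ + X]big_nat_cond [X in _ + X]big1 ?addr0 // => i.
  by rewrite andbT => /andP[ni _]; rewrite rX ?mulr0.
(* The inner bound is widened from [i] to [n] so that the two sums can be exchanged; for fixed [s]
   only [i = q ^ s] then remains. *)
under eq_bigr => i _.
  rewrite hp; last by rewrite -ltnS.
  rewrite /ps_frob big_distrl /=.
  rewrite -(big_mkord (fun s => i == q ^ s :> nat)%N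
    (fun s => u s * (r ^+ i)`_n)).
  rewrite (big_nat_widen _ _ n.+1) ?ltnS -1?ltnS // big_mkord.
  over.
rewrite (exchange_big_dep xpredT) //=.
transitivity (\sum_(s < n.+1 | (q ^ s <= n)%N) u s * (r ^+ (q ^ s))`_n).
  rewrite [RHS]big_mkcond /=; apply: eq_bigr => s _; case: ifP => hs.
    have hs' : (q ^ s < n.+1)%N by [].
    rewrite (bigD1 (Ordinal hs')) /=; last first.
      by rewrite eqxx ltnS ltnW // ltn_expl.
    rewrite big1 ?addr0 // => i /andP[/andP[/eqP hi _]].
    by rewrite -val_eqE /= hi eqxx.
  rewrite big1 // => i /andP[/eqP hi _].
  by rewrite -hi -ltnS ltn_ord in hs.
under eq_bigr => s hs do rewrite coef_exp_frob.
(* If [n] is not a power of $q$, then neither is $n/q^s$, so every term vanishes. *)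
have [[k nk]|/forallNP hn] := pselect (exists k, n = (q ^ k)%N); last first.
  rewrite [RHS]ps_frob_eq0 // big1 // => -[s /= _] hs; case: ifP => [/dvdnP[m hm]|_].
    rewrite hm mulnK ?(frob_gt0 hq) //.
    rewrite hr; last by rewrite hm leq_pmulr ?(frob_gt0 hq).
    rewrite ps_frob_eq0 ?(frob0 hq) ?mulr0 // => k mk.
    by apply: (hn (k + s)%N); rewrite hm mk expnD.
  by rewrite mulr0.
have kn : (k <= n)%N by rewrite nk ltnW // ltn_expl.
rewrite nk ps_frob_expn tserM -nk.
rewrite -(big_mkord xpredT (fun i => u i * v (k - i)%N ^+ (q ^ i))).
rewrite (big_nat_widen _ _ n.+1) // big_mkord.
apply: eq_big => [[s /= _]|[s /= _]]; first by rewrite nk leq_exp2l ?ltnS.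
rewrite nk leq_exp2l // => sk.
rewrite dvdn_exp2l // -expnB ?(ltnW q_gt1) //.
by rewrite hr ?ps_frob_expn // nk leq_exp2l // leq_subr.
Qed.

Lemma ps_comp_frob (u v : T) n :
  ps_comp (ps_frob q u) (ps_frob q v) n = ps_frob q (u * v) n.
Proof.
apply: coef_comp_frob => m mn; rewrite coef_poly ltnS mn //.
Qed.

End FrobeniusSeries.

(** * The twisted polynomials of a Drinfeld module *)

Section FiniteField.
Variable F : finFieldType.

(** The additive group of [F] is an elementary abelian $p$-group. *)
Lemma pnat_card : [pchar F].-nat #|F|.
Proof.
have [p p_pr pF] := finPcharP F.
have: p.-nat #|[set: F]| := abelem_pgroup (fin_ring_pchar_abelem pF).
rewrite cardsT; apply: sub_in_pnat => r _; rewrite inE => /eqP->; exact: pF.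
Qed.

Lemma pnat_card_poly : [pchar {poly F}].-nat #|F|.
Proof. exact (@pnat_rmorph F _ polyC _ pnat_card). Qed.

Lemma card_gt1 : (1 < #|F|)%N. Proof. exact: finNzRing_gt1. Qed.

Lemma expf_cardX i (x : F) : x ^+ (#|F| ^ i) = x.
Proof.
by elim: i => [|i IHi]; rewrite ?expr1 // expnSr exprM IHi expf_card.
Qed.

End FiniteField.

Section Twist.
Variables (F : finFieldType) (phi : drinfeld F).
Local Notation A := {poly F}.
Local Notation q := #|F|.
Local Notation qA := (pnat_card_poly F).

Definition dm_tser : tser qA := fun i => phi`_i.

Definition scalar_tser : F -> tser qA := @tserC A q qA \o polyC.
HB.instance Definition _ := GRing.RMorphism.on scalar_tser.

(** Elements of $\mathbb{F}_q$ are fixed by the $q$-th power, hence commute with $\tau$. This is the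
    condition under which evaluating polynomials at $\phi_\theta$ is a ring morphism into a
    noncommutative ring. *)
Lemma scalar_tser_comm : commr_rmorph scalar_tser dm_tser.
Proof.
move=> x; apply: funext => n; rewrite /scalar_tser /= tserMC tserCM mulrC.
by rewrite -polyC_exp expf_cardX.
Qed.

(* phi_a as an element of A{{tau}} *)
Definition twist : A -> tser qA := horner_morph scalar_tser_comm.
HB.instance Definition _ :=
  GRing.RMorphism.copy twist (horner_morph scalar_tser_comm).

Lemma twistE a :
  twist a = \sum_(j < size a) tserC qA (a`_j)%:P * dm_tser ^+ j.
Proof. by rewrite /twist /horner_morph /= /map_poly horner_poly. Qed.

Lemma twistX : twist 'X = dm_tser.
Proof. exact: horner_morphX. Qed.

(** Taking the coefficient of $\tau^0$ is multiplicative, and $\phi_\theta$ starts with $\theta$. *)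
Lemma twist_coef0 a : twist a 0%N = a.
Proof.
have dmX j : (dm_tser ^+ j) 0%N = 'X^j.
  elim: j => // j IHj.
  by rewrite exprS tserM big_ord1 subn0 expr1 IHj /dm_tser dm_coef0 exprS.
rewrite twistE tser_sum -[RHS]coefK poly_def; apply: eq_bigr => j _.
by rewrite tserCM dmX mul_polyC.
Qed.

Section Iota.
Variables (R : comNzRingType) (iota : {rmorphism A -> R}).
Variable hR : [pchar R].-nat q.

Lemma ps_frob_sum (I : Type) (r : seq I) (Q : pred I) (G : I -> tser hR) n :
  ps_frob q (\sum_(j <- r | Q j) G j) n = \sum_(j <- r | Q j) ps_frob q (G j) n.
Proof.
rewrite /ps_frob [RHS]exchange_big; apply: eq_bigr => i _.
by rewrite tser_sum.
Qed.

Lemma ps_frobZ (x : R) (u : tser hR) n :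
  ps_frob q (tserC hR x * u) n = x * ps_frob q u n.
Proof.
by rewrite /ps_frob big_distrr /=; apply: eq_bigr => i _; rewrite tserCM.
Qed.

Lemma coef_phi_theta n :
  (phi_theta iota phi)`_n = ps_frob q (tmap iota hR dm_tser) n.
Proof.
rewrite /phi_theta coef_sum; under eq_bigr => i _ do rewrite coefZ coefXn.
have [[k ->]|/forallNP hn] := pselect (exists k, n = (q ^ k)%N); last first.
  rewrite ps_frob_eq0 // big1 // => i _.
  by case: eqP => [/hn//|_]; rewrite mulr0.
rewrite ps_frob_expn ?card_gt1 // /tmap /dm_tser.
have [ks|sk] := ltnP k (size phi).
  rewrite (bigD1 (Ordinal ks)) //= eqxx mulr1 big1 ?addr0 // => i.
  rewrite -val_eqE eqn_exp2l ?card_gt1 //= eq_sym => /negbTE ->.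
  by rewrite mulr0.
rewrite (nth_default _ sk) rmorph0 big1 // => i _.
rewrite eqn_exp2l ?card_gt1 // gtn_eqF ?mulr0 //.
exact: leq_trans (ltn_ord i) sk.
Qed.

Lemma coef_iter_phi_theta j n :
  (iter j (fun p => phi_theta iota phi \Po p) 'X)`_n
  = ps_frob q (tmap iota hR dm_tser ^+ j) n.
Proof.
elim: j n => [|j IHj] n /=; last first.
  rewrite exprS; apply: coef_comp_frob => [|m _|m _]; first exact: card_gt1.
    exact: coef_phi_theta.
  exact: IHj.
rewrite coefX; have [[k ->]|/forallNP hn] := pselect (exists k, n = (q ^ k)%N).
  have -> : (q ^ k == 1)%N = (k == 0)%N.
    by rewrite -[1%N in LHS](expn0 q) eqn_exp2l ?card_gt1.
  by rewrite ps_frob_expn ?card_gt1 //; case: k.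
rewrite ps_frob_eq0 //; case: eqP => // n1.
by case: (hn 0%N); rewrite expn0.
Qed.

(** The bridge between the two forms of $\phi_a$: iterated composition of $\phi_\theta(X)$ becomes a
    power in $R\{\{\tau\}\}$, so identities between the $\phi_a(X)$ follow from [twist] being a ring
    morphism. *)
Lemma coef_phi_poly a n :
  (phi_poly iota phi a)`_n = ps_frob q (tmap iota hR (twist a)) n.
Proof.
rewrite /phi_poly twistE rmorph_sum ps_frob_sum coef_sum.
apply: eq_bigr => j _.
by rewrite rmorphM rmorphXn /= tmapC ps_frobZ coefZ coef_iter_phi_theta.
Qed.

End Iota.

Section PhiPoly.
Variables (R : comNzRingType) (iota : {rmorphism A -> R}).
Let hR : [pchar R].-nat q := pnat_rmorph iota qA.

Lemma phi_polyM a b :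
  phi_poly iota phi (a * b) = phi_poly iota phi a \Po phi_poly iota phi b.
Proof.
apply/polyP => n; rewrite (coef_phi_poly iota hR) rmorphM rmorphM /=; symmetry.
by apply: coef_comp_frob => [|m _|m _]; rewrite ?card_gt1 // coef_phi_poly.
Qed.

Lemma phi_polyD a b :
  phi_poly iota phi (a + b) = phi_poly iota phi a + phi_poly iota phi b.
Proof.
apply/polyP => n; rewrite coefD !(coef_phi_poly iota hR) !rmorphD /=.
by rewrite /ps_frob -big_split.
Qed.

Lemma phi_poly0 : phi_poly iota phi 0 = 0.
Proof. by rewrite /phi_poly size_poly0 big_ord0. Qed.

Lemma phi_poly1 : phi_poly iota phi 1 = 'X.
Proof.
by rewrite /phi_poly size_poly1 big_ord1 coefC eqxx rmorph1 scale1r.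
Qed.

Lemma phi_poly_sum a : exists N,
  phi_poly iota phi a = \sum_(i < N) iota (twist a i) *: 'X^(q ^ i).
Proof.
(* A crude bound that suffices: the index [i] contributes to the exponent $q^i>i$. *)
exists (size (phi_poly iota phi a)); apply/polyP => n.
rewrite [RHS]coef_sum; under [RHS]eq_bigr => i _ do rewrite coefZ coefXn.
have [[k ->]|/forallNP hn] := pselect (exists k, n = (q ^ k)%N); last first.
  rewrite (coef_phi_poly iota hR) ps_frob_eq0 // big1 // => i _.
  by case: eqP => [/hn//|_]; rewrite mulr0.
have -> : (phi_poly iota phi a)`_(q ^ k) = iota (twist a k).
  by rewrite (coef_phi_poly iota hR) ps_frob_expn ?card_gt1.
have [ks|sk] := ltnP k (size (phi_poly iota phi a)).
  rewrite (bigD1 (Ordinal ks)) //= eqxx mulr1 big1 ?addr0 // => i.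
  rewrite -val_eqE eqn_exp2l ?card_gt1 //= eq_sym => /negbTE ->.
  by rewrite mulr0.
(* For [k] beyond the bound, this is a coefficient of index $q^k>k$, past the degree, hence zero. *)
have -> : iota (twist a k) = (phi_poly iota phi a)`_(q ^ k).
  by rewrite (coef_phi_poly iota hR) ps_frob_expn ?card_gt1.
rewrite nth_default; last first.
  by rewrite (leq_trans sk) // ltnW // ltn_expl // card_gt1.
rewrite big1 // => i _; rewrite eqn_exp2l ?card_gt1 // gtn_eqF ?mulr0 //.
exact: leq_trans (ltn_ord i) sk.
Qed.

End PhiPoly.
End Twist.

(** * Arithmetic of the residue field $A/f$ *)

Section ResidueField.
Variables (F : finFieldType) (f : {poly F}) (hf : monic_irreducible_poly f).
Local Notation A := {poly F}.
Local Notation q := #|F|.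
Local Notation k := {poly %/ f with hf}.
Local Notation d := (size f).-1.

Lemma irred_gt1 : (1 < size f)%N. Proof. by case: hf => -[]. Qed.
Lemma irred_neq0 : f != 0.
Proof. by rewrite -size_poly_gt0 ltnW // irred_gt1. Qed.
Lemma deg_irred_gt0 : (0 < d)%N.
Proof. by rewrite -ltnS prednK ?irred_gt1 // ltnW // irred_gt1. Qed.

Definition to_residue : A -> k := in_qpoly f.
HB.instance Definition _ := GRing.RMorphism.copy to_residue (in_qpoly f).

Lemma to_residue_eq0 a : (to_residue a == 0) = (f %| a).
Proof.
rewrite -val_eqE /= (_ : mk_monic f = f); last exact: mk_monicE.
by rewrite Pdiv.Field.dvdpE.
Qed.

Lemma to_residue_surj (x : k) : exists a, x = to_residue a.
Proof.
exists (val x); apply: val_inj; apply: esym.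
by apply: in_qpoly_small; apply: size_mk_monic.
Qed.

Lemma irred_dvdM a b : (f %| a * b) = (f %| a) || (f %| b).
Proof. by rewrite -!to_residue_eq0 rmorphM mulf_eq0. Qed.

Lemma irred_dvdX a n : f %| a ^+ n -> f %| a.
Proof. by rewrite -!to_residue_eq0 rmorphXn expf_eq0 => /andP[]. Qed.

(** The residue field has $q^d$ elements. *)
Lemma fermat a : f %| a ^+ (q ^ d) - a.
Proof.
rewrite -to_residue_eq0 rmorphB rmorphXn /= -(card_qfpoly hf).
by rewrite expf_card subrr.
Qed.

(** The class of $\theta$ generates the residue field over $\mathbb{F}_q$. If the $q^i$-th power
    fixed it, all $q^d$ residue classes would be roots of $X^{q^i}-X$, too many for its degree. *)
Lemma ndvd_frob_lt_deg i : (0 < i < d)%N -> ~~ (f %| 'X ^+ (q ^ i) - 'X).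
Proof.
case/andP=> i0 id; rewrite -to_residue_eq0; apply/negP => /eqP.
rewrite rmorphB rmorphXn /= => /eqP; rewrite subr_eq0 => /eqP thq.
have hk : [pchar k].-nat q := pnat_rmorph to_residue (pnat_card_poly F).
have fixk a : to_residue a ^+ (q ^ i) = to_residue a.
  elim/poly_ind: a => [|a x IHa]; first by rewrite rmorph0 (frob0 hk).
  rewrite rmorphD rmorphM (frobD hk) exprMn IHa thq /=; congr (_ + _).
  by rewrite -rmorphXn /= -polyC_exp expf_cardX.
pose p : {poly k} := 'X ^+ (q ^ i) - 'X.
have q1 : (1 < q ^ i)%N by rewrite -(expn0 q) ltn_exp2l ?card_gt1.
have sp : size p = (q ^ i).+1.
  by rewrite size_polyDl size_polyXn // size_polyN size_polyX ltnS.
have: (size (enum k) < size p)%N.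
  apply: max_poly_roots; rewrite ?enum_uniq -?size_poly_eq0 ?sp //.
  apply/allP => x _; have [a ->] := to_residue_surj x.
  by rewrite rootE !hornerE fixk subrr.
by rewrite -cardE card_qfpoly sp ltnS leqNgt ltn_exp2l ?card_gt1 ?id.
Qed.

(* The derivative of theta^(q^i) - theta is -1. *)
Lemma ndvd_frob_sqr i : (0 < i)%N -> ~~ (f ^+ 2 %| 'X ^+ (q ^ i) - 'X).
Proof.
move=> i0; apply/negP => /dvdpP[p hp].
have: f %| (('X : A) ^+ (q ^ i) - 'X)^`().
  rewrite hp expr2 mulrA derivM; apply: dvdp_add; first exact: dvdp_mull.
  by apply: dvdp_mulr; apply: dvdp_mull.
rewrite derivB derivXn derivX (_ : _ *+ (q ^ i) = 0) ?sub0r ?dvdpNr.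
  by rewrite dvdp1 gtn_eqF // irred_gt1.
rewrite -mulr_natr (_ : (q ^ i)%:R = 0 :> A) ?mulr0 //.
rewrite -(prednK i0) expnS natrM.
have [p' p_pr pF] := finPcharP F.
suff -> : q%:R = 0 :> A by rewrite mul0r.
apply/eqP; rewrite -(rmorph_nat polyC) polyC_eq0 -[_ == 0]negbK natf_neq0_pchar.
apply/negP => h; have := pnat_1 (pnat_card F) h => q1.
by have := card_gt1 F; rewrite q1.
Qed.

End ResidueField.

(** * The Carlitz module modulo $f$ *)

Section CarlitzModF.
Variables (F : finFieldType) (f : {poly F}) (hf : monic_irreducible_poly f).
Local Notation A := {poly F}.
Local Notation q := #|F|.
Local Notation d := (size f).-1.
Local Notation qA := (pnat_card_poly F).
Local Notation D := (dm_tser (carlitz F)).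

Lemma carlitz_tser : D = tserC qA 'X + tserX qA 1.
Proof.
apply: funext => n; rewrite tserD /dm_tser /= /carlitz_coef.
by rewrite coefD coefX coefC /tserC /tserX.
Qed.

(** The power $(\theta+\tau)^j$ is monic of degree $j$ in $\tau$. *)
Lemma carlitz_tserX j i : (j <= i)%N -> (D ^+ j) i = (i == j)%:R.
Proof.
elim: j i => [|j IHj] i ji; first by case: i ji.
rewrite exprSr carlitz_tser mulrDr tserD tserMC tserMX -carlitz_tser.
rewrite (leq_ltn_trans _ ji) // !IHj ?(ltnW ji) //; last first.
  by rewrite -ltnS subn1 prednK // (leq_ltn_trans _ ji).
by rewrite gtn_eqF // mul0r add0r -eqSS subn1 prednK // (leq_ltn_trans _ ji).
Qed.

Lemma twist_carlitz_ge i : (d <= i)%N ->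
  twist (carlitz F) f i = (i == d)%:R.
Proof.
move=> di; have sf : size f = d.+1 by rewrite prednK // ltnW // (irred_gt1 hf).
rewrite twistE tser_sum sf big_ord_recr /= big1 => [|j _].
  by rewrite add0r tserCM carlitz_tserX // -/(lead_coef f) (eqP hf.2) mul1r.
have ji := leq_trans (ltn_ord j) di.
by rewrite tserCM carlitz_tserX ?(ltnW ji) // gtn_eqF // mulr0.
Qed.

(** Since $C_f=\sum c_i\tau^i$ commutes with $C_\theta$, comparing coefficients of $\tau^{i+1}$
    gives $c_{i+1}(\theta^{q^{i+1}}-\theta)=c_i^q-c_i$. The prime $f$ does not divide the bracket
    while $i+1<d$, so divisibility propagates from $c_0=f$. *)
Lemma twist_carlitz_dvd i : (i < d)%N -> f %| twist (carlitz F) f i.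
Proof.
elim: i => [|i IHi] id; first by rewrite twist_coef0.
pose c := twist (carlitz F) f.
have: c * D = D * c by rewrite -twistX /c -!rmorphM mulrC.
move/(congr1 (fun u : tser qA => u i.+1)).
rewrite carlitz_tser mulrDr mulrDl !tserD tserMC tserCM tserMX tserXM /= subn1 /=.
rewrite expn1 => h.
have: f %| c i.+1 * ('X ^+ (q ^ i.+1) - 'X).
  have -> : c i.+1 * ('X ^+ (q ^ i.+1) - 'X) = c i ^+ q - c i.
    apply/eqP; rewrite mulrBr subr_eq -addrA [- _ + _]addrC addrA eq_sym.
    by rewrite subr_eq [_ * 'X]mulrC [_ + 'X * _]addrC -h.
  have fc := IHi (ltnW id).
  by rewrite dvdp_sub // -(prednK (ltnW (card_gt1 F))) exprS dvdp_mulr.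
by rewrite (irred_dvdM hf) (negbTE (ndvd_frob_lt_deg hf _)) ?orbF.
Qed.

Lemma phi_poly_carlitz (R : comNzRingType) (iota : {rmorphism A -> R}) :
  exists w : {poly A},
    phi_poly iota (carlitz F) f = 'X ^+ (q ^ d) + (iota f)%:P * map_poly iota w.
Proof.
pose c := twist (carlitz F) f.
(* The witness is $(C_f-\tau^d)/f$, an exact quotient by the two preceding lemmas. *)
exists (\sum_(i < d) (c i %/ f) *: 'X^(q ^ i)).
pose hR : [pchar R].-nat q := pnat_rmorph iota qA.
apply/polyP => n; rewrite (coef_phi_poly _ _ hR) coefD coefXn mul_polyC coefZ.
rewrite coef_map /= coef_sum.
under eq_bigr => i _ do rewrite coefZ coefXn.
have [[k ->]|/forallNP hn] := pselect (exists k, n = (q ^ k)%N); last first.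
  rewrite ps_frob_eq0 // big1 ?rmorph0 ?mulr0 ?addr0 => [|i _].
    by case: eqP => // /hn.
  by case: eqP => [/hn//|_]; rewrite mulr0.
rewrite ps_frob_expn ?card_gt1 // eqn_exp2l ?card_gt1 // /tmap -rmorphM /=.
have [kd|dk] := ltnP k d.
  rewrite (ltn_eqF kd) add0r (bigD1 (Ordinal kd)) //= eqxx mulr1.
  rewrite big1 ?addr0; first by rewrite mulrC divpK // twist_carlitz_dvd.
  move=> i; rewrite -val_eqE eqn_exp2l ?card_gt1 //= eq_sym => /negbTE ->.
  by rewrite mulr0.
rewrite twist_carlitz_ge // rmorph_nat big1 ?mulr0 ?rmorph0 ?addr0 // => i _.
rewrite eqn_exp2l ?card_gt1 // gtn_eqF ?mulr0 //.
exact: leq_trans (ltn_ord i) dk.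
Qed.

End CarlitzModF.

(** * Frobenius on the Tate module *)

Section ReducedAction.
Variables (F : finFieldType) (g : {poly F}) (hg : monic_irreducible_poly g).
Variable phi : drinfeld F.
Local Notation A := {poly F}.
Local Notation q := #|F|.
Local Notation d := (size g).-1.
Local Notation kbar := (residue_closure hg).

HB.instance Definition _ := GRing.RMorphism.copy (reduce hg)
  (sval (projT2 (countable_algebraic_closure {poly %/ g with hg}))
     \o to_residue hg).

Lemma reduce_eq0 a : (reduce hg a == 0) = (g %| a).
Proof.
rewrite -(to_residue_eq0 hg).
exact: (fmorph_eq0 (sval (projT2 (countable_algebraic_closure _)))).
Qed.

Lemma reduce_frob a : reduce hg a ^+ (q ^ d) = reduce hg a.
Proof.
apply/eqP; rewrite -subr_eq0 -rmorphXn -rmorphB reduce_eq0.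
exact: fermat.
Qed.

Let hk : [pchar kbar].-nat q := pnat_rmorph (reduce hg) (pnat_card_poly F).

Local Notation act := (@red_act F g hg phi).

Lemma red_actD a b y : act (a + b) y = act a y + act b y.
Proof. by rewrite /red_act phi_polyD hornerD. Qed.

Lemma red_actM a b y : act (a * b) y = act a (act b y).
Proof. by rewrite /red_act phi_polyM horner_comp. Qed.

Lemma red_act1 y : act 1 y = y.
Proof. by rewrite /red_act phi_poly1 hornerX. Qed.

Lemma red_act0 y : act 0 y = 0.
Proof. by rewrite /red_act phi_poly0 horner0. Qed.

Lemma red_act_expE a : exists N, forall y,
  act a y = \sum_(i < N) reduce hg (twist phi a i) * y ^+ (q ^ i).
Proof.
have [N hN] := phi_poly_sum phi (reduce hg) a; exists N => y.
rewrite /red_act hN horner_sum; apply: eq_bigr => i _.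
by rewrite hornerZ hornerXn.
Qed.

Lemma red_act_addr a y z : act a (y + z) = act a y + act a z.
Proof.
have [N hN] := red_act_expE a; rewrite !hN -big_split; apply: eq_bigr => i _.
by rewrite (frobD hk) mulrDr.
Qed.

Lemma red_act_0r a : act a 0 = 0.
Proof.
have [N ->] := red_act_expE a; apply: big1 => i _.
by rewrite (frob0 hk) mulr0.
Qed.

Lemma red_act_sumr a (I : Type) (r : seq I) (Q : pred I) (G : I -> kbar) :
  act a (\sum_(i <- r | Q i) G i) = \sum_(i <- r | Q i) act a (G i).
Proof.
by elim/big_rec2: _ => [|i y x _ <-]; rewrite ?red_act_0r ?red_act_addr.
Qed.

(** The coefficients of the reduced $\phi_a$ lie in a field with $q^d$ elements, so $\tau^d$ fixes
    them and commutes with the action of $A$. *)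
Lemma red_act_frob a y s :
  act a y ^+ (q ^ (d * s)) = act a (y ^+ (q ^ (d * s))).
Proof.
have fixX b : reduce hg b ^+ (q ^ (d * s)) = reduce hg b.
  elim: s => [|s IHs]; first by rewrite muln0 expr1.
  by rewrite mulnS expnD exprM reduce_frob IHs.
have [N hN] := red_act_expE a; rewrite !hN (frob_sum hk).
by apply: eq_bigr => i _; rewrite exprMn fixX exprAC.
Qed.

Section Adic.
Variables (l : A) (hl : monic_irreducible_poly l).

Lemma adic_val_sum (I : Type) (r : seq I) (Q : pred I) (G : I -> adic hl) n :
  adic_val (\sum_(i <- r | Q i) G i) n = \sum_(i <- r | Q i) adic_val (G i) n.
Proof. by elim/big_rec2: _ => [|i y x _ <-]; rewrite /= ?mod0p. Qed.

Lemma adic_act_sum (I : Type) (r : seq I) (Q : pred I) (G : I -> adic hl) n y :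
  act (adic_val (\sum_(i <- r | Q i) G i) n) y
  = \sum_(i <- r | Q i) act (adic_val (G i) n) y.
Proof.
rewrite adic_val_sum.
by elim/big_rec2: _ => [|i z x _ <-]; rewrite ?red_act0 ?red_actD.
Qed.

(** Scalars of $A_\lambda$ act through remainders modulo $\lambda^n$; on $\lambda^n$-torsion the
    truncation is harmless. *)
Lemma act_modp a n y : act (l ^+ n) y = 0 -> act (a %% l ^+ n) y = act a y.
Proof.
move=> hy; rewrite [in RHS](divp_eq a (l ^+ n)) red_actD red_actM hy.
by rewrite red_act_0r add0r.
Qed.

Lemma in_tate_torsion x n : in_tate phi l x -> act (l ^+ n) (x n) = 0.
Proof.
case=> x0 xS; elim: n => [|n IHn]; first by rewrite red_act1.
by rewrite exprSr red_actM xS.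
Qed.

(** At level $n$ equal to the size of $a-b$, the degree of $\lambda^n$ exceeds that of $a-b$, so the
    remainder is $a-b$ itself. *)
Lemma adic_of_inj : injective (adic_of hl).
Proof.
move=> a b ab; apply/eqP; rewrite -subr_eq0; apply/eqP.
have: adic_of hl (a - b) = 0 by rewrite rmorphB /= ab subrr.
move/(congr1 (fun x : adic hl => adic_val x (size (a - b)))) => /=.
rewrite mod0p modp_small // -[ltnRHS]prednK; last first.
  by rewrite size_poly_gt0 expf_neq0 // (irred_neq0 hl).
by rewrite ltnS size_exp leq_pmull // (deg_irred_gt0 hl).
Qed.

(** A characteristic polynomial is monic of degree $r_0$ over $A_\lambda$; injectivity of $A\to
    A_\lambda$ brings both facts back to [P]. *)
Lemma frob_char_poly_size r0 P :
  frob_char_poly hg phi hl r0 P -> size P = r0.+1 /\ P`_r0 = 1.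
Proof.
case=> e [M [_ _ hP]].
have := size_char_poly M; rewrite -hP size_map_poly_id0; last first.
  apply/eqP; rewrite -(rmorph0 (adic_of hl)) => /adic_of_inj /eqP.
  rewrite lead_coef_eq0 => /eqP P0; have := char_poly_monic M.
  by rewrite -hP P0 rmorph0 monicE lead_coef0 eq_sym oner_eq0.
move=> sP; split=> //; apply: adic_of_inj; rewrite rmorph1.
have := char_poly_monic M; rewrite monicE /lead_coef size_char_poly -hP /=.
by rewrite coef_map => /eqP.
Qed.

Variables (r0 : nat) (e : 'I_r0.+1 -> nat -> kbar) (M : 'M[adic hl]_r0.+1).
Hypotheses (he : tate_basis phi hl e) (hM : frob_mx phi e M).

Lemma basis_torsion j n : act (l ^+ n) (e j n) = 0.
Proof. by apply: in_tate_torsion; apply: he.1. Qed.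

(** Because $\tau^d$ commutes with $A$, its iterates act through the powers of [M]. The size is
    written [r0.+1] so that square matrices form a nonzero ring in which these powers make sense. *)
Lemma basis_frob s j n :
  e j n ^+ (q ^ (d * s)) = \sum_i act (adic_val ((M ^+ s) i j) n) (e i n).
Proof.
elim: s j => [|s IHs] j.
  rewrite muln0 expr1 expr0 (bigD1 j) //= mxE eqxx big1 ?addr0 => [|i /negbTE ij].
    by rewrite act_modp ?red_act1 ?basis_torsion.
  by rewrite mxE ij /= mod0p red_act0.
rewrite mulnS expnD exprM hM /tate_comb (frob_sum hk).
under eq_bigr => i _ do rewrite red_act_frob IHs red_act_sumr.
rewrite exchange_big; apply: eq_bigr => k _ /=.
rewrite exprSr mxE adic_act_sum; apply: eq_bigr => i _ /=.
by rewrite act_modp ?basis_torsion // mulrC red_actM.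
Qed.

(** This is column [j] of the Cayley-Hamilton identity for [M], read at level [n]. *)
Lemma basis_root (P : {poly A}) j n : map_poly (adic_of hl) P = char_poly M ->
  \sum_(s < size P) act P`_s (e j n ^+ (q ^ (d * s))) = 0.
Proof.
move=> hP; have := Cayley_Hamilton M; rewrite -hP /horner_mx /horner_morph.
rewrite (horner_coef_wide M (n := size P)); last first.
  by rewrite (leq_trans (size_poly _ _)) ?size_poly.
move=> CH.
transitivity (\sum_k act (adic_val ((0 : 'M[adic hl]_r0.+1) k j) n) (e k n)).
  rewrite -CH.
  under [RHS]eq_bigr => k _ do rewrite summxE adic_act_sum.
  rewrite exchange_big; apply: eq_bigr => s _ /=.
  rewrite basis_frob red_act_sumr; apply: eq_bigr => k _.
  rewrite !coef_map /= -[_%:M * _]/(_%:M *m _) mul_scalar_mx mxE /=.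
  rewrite act_modp ?basis_torsion // red_actM act_modp //.
  by rewrite -red_actM mulrC red_actM basis_torsion red_act_0r.
by apply: big1 => k _; rewrite mxE /= mod0p red_act0.
Qed.

(** Otherwise the zero point would have two coordinate vectors, 0 and the [j]-th unit vector,
    against uniqueness. *)
Lemma basis_neq0 j : exists n, e j n != 0.
Proof.
apply: contrapT => /forallNP h0.
have e0 n : e j n = 0 by apply/eqP; apply: contrapT => /negP /h0.
have [c [_ huniq]] := he.2 (fun=> 0) (conj erefl (fun=> red_act_0r _)).
have h (b : {ffun 'I_r0.+1 -> adic hl}) : (forall i, i != j -> b i = 0) ->
    forall n, 0 = tate_comb phi e b n.
  move=> hb n; rewrite /tate_comb big1 // => i _.
  have [->|/hb ->] := eqVneq i j; first by rewrite e0 red_act_0r.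
  by rewrite /= mod0p red_act0.
pose b : {ffun 'I_r0.+1 -> adic hl} := [ffun i => if i == j then 1 else 0].
have : b = [ffun=> 0].
  rewrite -(huniq b) ?(huniq [ffun=> 0]) //; apply: h => i ij;
    by rewrite ffunE ?(negbTE ij).
move/ffunP/(_ j)/eqP; rewrite !ffunE eqxx; exact/negP/oner_neq0.
Qed.

Lemma basis_sub j n t : (t <= n)%N -> act (l ^+ t) (e j n) = e j (n - t)%N.
Proof.
elim: t => [|t IHt] tn; first by rewrite red_act1 subn0.
rewrite exprS red_actM IHt ?(ltnW tn) //.
by have:= (he.1 j).2 (n - t.+1)%N; rewrite -subSn // subSS.
Qed.

Lemma basis_infinite j N : exists s : seq kbar,
  [/\ uniq s, size s = N & forall y, y \in s -> exists n, y = e j n].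
Proof.
have [m hm] := basis_neq0 j.
have m0 : (0 < m)%N.
  by rewrite lt0n; apply: contra_neq hm => ->; case: (he.1 j).
(* The levels are multiples of an [m] with [e j m] nonzero. If levels $mi<mi'$ gave the same point,
   acting by $\lambda^{mi}$ would kill the point of level $m(i'-i)$, and lowering it further to
   level [m] would give [e j m = 0]. *)
exists [seq e j (m * i)%N | i <- iota 0 N]; split; last 2 first.
- by rewrite size_map size_iota.
- by move=> y /mapP[i _ ->]; exists (m * i)%N.
rewrite map_inj_in_uniq ?iota_uniq //.
suff lt_neq i i' : (i < i')%N -> e j (m * i)%N <> e j (m * i')%N.
  move=> i i' _ _ ii'; case: (ltngtP i i') => // [/lt_neq|/lt_neq] //.
  by move/(_ (esym ii')).
move=> ii' /(congr1 (act (l ^+ (m * i)))).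
rewrite !basis_sub ?leq_mul2l ?leqnn ?(ltnW ii') ?orbT // subnn -mulnBr.
case: (he.1 j) => -> _ => h.
case/eqP: hm; rewrite -(red_act_0r (l ^+ (m * (i' - i) - m))) h.
have le : (m <= m * (i' - i))%N by rewrite leq_pmulr ?subn_gt0.
by rewrite basis_sub ?leq_subr // subKn.
Qed.

End Adic.

(* P_g(tau^d) kills every point of the Tate module, hence vanishes as an
   F_q-linear polynomial over the residue field: it has infinitely many
   roots. *)
Lemma frob_char_poly_twist (l : A) (hl : monic_irreducible_poly l) r0 P i :
  (0 < r0)%N -> frob_char_poly hg phi hl r0 P ->
  g %| (\sum_(s < size P) twist phi P`_s * tserX _ (d * s)%N) i.
Proof.
case: r0 => // r0 _ [e [M [he hM hP]]].
pose u := \sum_(s < size P) twist phi P`_s * tserX _ (d * s)%N.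
rewrite -/u -reduce_eq0.
(* The $\mathbb{F}_q$-linear polynomial over [kbar] attached to the reduction of [u]. *)
pose p : {poly kbar} :=
  \sum_(s < size P) (phi_poly (reduce hg) phi P`_s \Po 'X^(q ^ (d * s))).
have coefp n : p`_n = ps_frob q (tmap (reduce hg) hk u) n.
  rewrite /p coef_sum rmorph_sum ps_frob_sum; apply: eq_bigr => s _.
  rewrite rmorphM /= tmapX.
  apply: coef_comp_frob => [|m _|m _]; first exact: card_gt1.
    exact: coef_phi_poly.
  rewrite coefXn.
  have [[k ->]|/forallNP hn] := pselect (exists k, m = (q ^ k)%N).
    by rewrite eqn_exp2l ?ps_frob_expn ?card_gt1.
  by rewrite ps_frob_eq0 //; case: eqP => // /hn.
have p0 : p = 0.
  have [rs [rs_uniq rs_size hrs]] := basis_infinite he ord0 (size p).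
  apply: (roots_geq_poly_eq0 (rs := rs)); rewrite ?rs_size //.
  apply/allP => y /hrs[n ->]; rewrite rootE /p horner_sum.
  under eq_bigr => s _ do rewrite horner_comp hornerXn.
  by apply/eqP; apply: basis_root he hM _ _ _ hP.
by rewrite -[reduce hg _]/(tmap (reduce hg) hk u i)
  -(ps_frob_expn (card_gt1 F)) -coefp p0 coef0.
Qed.

End ReducedAction.

(** * Integrality at f *)

Section LocalRing.
Variables (F : finFieldType) (f : {poly F}) (hf : monic_irreducible_poly f).
Local Notation A := {poly F}.
Local Notation K := {fraction A}.
Local Notation tof := (@tofrac A).

(** This is $A_{(f)}$ again. Asking for some denominator prime to $f$ makes the ring operations
    easy, unlike the order of a chosen representative in [loc_ring]; the irreducibility argument
    lets the subring structure be attached. *)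
Definition floc of monic_irreducible_poly f : {pred K} :=
  fun x => `[< exists a b, ~~ (f %| b) /\ x = tof a / tof b >].
Local Notation O := (floc hf).

Lemma flocP x : reflect (exists a b, ~~ (f %| b) /\ x = tof a / tof b) (x \in O).
Proof. exact: asboolP. Qed.

Lemma ndvd_tofrac_neq0 b : ~~ (f %| b) -> tof b != 0.
Proof. by rewrite tofrac_eq0; apply: contraNneq => ->; rewrite dvdp0. Qed.

Lemma floc_tofrac a : tof a \in O.
Proof.
apply/flocP; exists a, 1; rewrite rmorph1 divr1; split=> //.
by rewrite dvdp1 gtn_eqF // (irred_gt1 hf).
Qed.

Lemma floc_tofracV b : ~~ (f %| b) -> (tof b)^-1 \in O.
Proof. by move=> hb; apply/flocP; exists 1, b; rewrite rmorph1 div1r. Qed.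

Fact floc_subring_closed : subring_closed O.
Proof.
split=> [|x y /flocP[a [b [hb ->]]] /flocP[a' [b' [hb' ->]]]|
          x y /flocP[a [b [hb ->]]] /flocP[a' [b' [hb' ->]]]].
- by rewrite -tofrac1 floc_tofrac.
- apply/flocP; exists (a * b' - a' * b), (b * b').
  rewrite (irred_dvdM hf) negb_or hb hb'; split=> //.
  rewrite -mulNr addf_div ?ndvd_tofrac_neq0 //.
  by rewrite rmorphB !rmorphM mulNr.
apply/flocP; exists (a * a'), (b * b').
rewrite (irred_dvdM hf) negb_or hb hb'; split=> //.
by rewrite mulf_div !rmorphM.
Qed.
HB.instance Definition _ :=
  GRing.isSubringClosed.Build K (floc hf) floc_subring_closed.

(** If $x=a/b$ with $f\nmid b$ and the chosen representative is $n/e$, then $nb=ae$, so every power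
    of $f$ dividing $e$ divides $n$. *)
Lemma floc_loc_ring x : x \in O -> x \in loc_ring f.
Proof.
case/flocP=> a [b [hb hx]]; rewrite /loc_ring unfold_in /=.
have [->|x0] := eqVneq x 0; first by [].
set n := \n_(repr x); set e := \d_(repr x).
have e0 : e != 0 := denom_ratioP (repr x).
have hne : x * tof e = tof n.
  rewrite -[x in LHS]reprK; unlock tofrac.
  rewrite -[LHS]FracField.pi_mul; apply/eqmodP => /=.
  rewrite FracField.equivfE /FracField.mulf.
  by rewrite !numden_Ratio ?mulf_neq0 ?oner_neq0 ?e0 //; rewrite !mulr1 mulrC.
have n0 : n != 0.
  by rewrite -tofrac_eq0 -hne mulf_neq0 ?tofrac_eq0.
have b0 := ndvd_tofrac_neq0 hb.
have nb : n * b = a * e.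
  by apply/eqP; rewrite -tofrac_eq !tofracM -hne hx mulrAC divfK.
rewrite subr_ge0 lez_nat /ord_poly; apply/bigmax_leqP => m hm.
have fn : f ^+ m %| n.
  have : f ^+ m %| n * b by rewrite nb dvdp_mull.
  rewrite Gauss_dvdpl // coprimep_expl //.
  by rewrite (irreducible_poly_coprime _ hf.1).
(* The exponent must lie in the range over which [ord_poly] takes its maximum. *)
have mn : (m < size n)%N.
  apply: leq_trans (dvdp_leq n0 fn).
  rewrite -[ltnRHS]prednK ?size_poly_gt0 ?expf_neq0 ?(irred_neq0 hf) //.
  by rewrite ltnS size_exp leq_pmull // (deg_irred_gt0 hf).
exact: (@leq_bigmax_cond _ (fun i : 'I_(size n) => f ^+ i %| n)
  (fun i : 'I_(size n) => i : nat) (Ordinal mn)).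
Qed.

Lemma expr_divB (R : fieldType) (u v : R) n : v != 0 ->
  (u / v) ^+ n - u / v = (u ^+ n * v - u * v ^+ n) / (v ^+ n * v).
Proof.
move=> v0; rewrite expr_div_n -mulNr addf_div ?expf_neq0 //.
by rewrite mulNr.
Qed.

(** With $Q=q^d$, the numerator of $(a/b)^Q-a/b$ is $a^Qb-ab^Q=(a^Q-a)b-a(b^Q-b)$, so Fermat in $A$
    applies twice. *)
Lemma floc_fermat x : x \in O ->
  (tof f)^-1 * (x ^+ (#|F| ^ (size f).-1) - x) \in O.
Proof.
case/flocP=> a [b [hb ->]]; set Q := (_ ^ _)%N.
have b0 := ndvd_tofrac_neq0 hb.
have f0 : tof f != 0 by rewrite tofrac_eq0 (irred_neq0 hf).
have hab : f %| a ^+ Q * b - a * b ^+ Q.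
  rewrite (_ : _ - _ = (a ^+ Q - a) * b - a * (b ^+ Q - b)).
    by apply: dvdp_sub; [apply: dvdp_mulr | apply: dvdp_mull]; apply: fermat.
  by rewrite mulrBl mulrBr opprB addrA subrK.
clearbody Q; apply/flocP; exists ((a ^+ Q * b - a * b ^+ Q) %/ f), (b ^+ Q * b).
split; first by rewrite (irred_dvdM hf) negb_or hb andbT;
  apply: contraNN hb => /(irred_dvdX hf).
apply: (mulfI f0); rewrite mulVKf // mulrA -rmorphM /= [f * _]mulrC divpK //.
rewrite (expr_divB _ _ b0); congr (_ / _).
  by rewrite rmorphB !rmorphM !rmorphXn.
by rewrite rmorphM rmorphXn.
Qed.

(** * Congruences modulo $f$ in $A_{(f)}[x]$ *)

Local Notation KX := {poly K}.

(* Membership in the ideal f O[x] of O[x]. *)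
Definition f_ideal (p : KX) : bool := (tof f)^-1 *: p \is a polyOver O.
Local Notation J := f_ideal.

Lemma f_ideal0 : J 0. Proof. by rewrite /f_ideal scaler0 rpred0. Qed.
Lemma f_idealD p r : J p -> J r -> J (p + r).
Proof. by rewrite /f_ideal scalerDr; apply: rpredD. Qed.
Lemma f_idealN p : J p -> J (- p).
Proof. by rewrite /f_ideal scalerN rpredN. Qed.
Lemma f_idealB p r : J p -> J r -> J (p - r).
Proof. by move=> hp hr; rewrite f_idealD ?f_idealN. Qed.
Lemma f_ideal_sum (I : Type) (r : seq I) (Q : pred I) (G : I -> KX) :
  (forall i, Q i -> J (G i)) -> J (\sum_(i <- r | Q i) G i).
Proof. by move=> h; elim/big_rec: _ => [|i y /h]; [exact: f_ideal0|exact: f_idealD]. Qed.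
Lemma f_idealMr p r : J p -> r \is a polyOver O -> J (p * r).
Proof. by rewrite /f_ideal scalerAl; apply: rpredM. Qed.
Lemma f_idealMl p r : r \is a polyOver O -> J p -> J (r * p).
Proof. by move=> hr hp; rewrite mulrC f_idealMr. Qed.

Lemma tofrac_f_neq0 : tof f != 0.
Proof. by rewrite tofrac_eq0 (irred_neq0 hf). Qed.

Lemma f_ideal_over p : J p -> p \is a polyOver O.
Proof.
move=> hp; rewrite -(scalerK tofrac_f_neq0 p) scalerA mulrC -scalerA -mul_polyC.
by apply: rpredM => //; rewrite polyOverC floc_tofrac.
Qed.

Lemma f_idealX p n : J p -> (0 < n)%N -> J (p ^+ n).
Proof.
case: n => // n hp _; rewrite exprS f_idealMr // rpredX //.
exact: f_ideal_over.
Qed.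

Lemma f_ideal_tofrac a : f %| a -> J (tof a)%:P.
Proof.
move=> fa; rewrite /f_ideal scale_polyC polyOverC -(divpK fa) [_ * f]mulrC tofracM.
by rewrite mulKf ?floc_tofrac // tofrac_f_neq0.
Qed.

Lemma f_ideal_mulf p : J ((tof f)%:P * p) -> p \is a polyOver O.
Proof. by rewrite /f_ideal mul_polyC scalerK // tofrac_f_neq0. Qed.

Lemma map_poly_over w : map_poly tof w \is a polyOver O.
Proof. by apply/polyOverP => i; rewrite coef_map floc_tofrac. Qed.

Lemma carlitz_over a : phi_poly tof (carlitz F) a \is a polyOver O.
Proof.
have [N ->] := phi_poly_sum (carlitz F) tof a.
rewrite rpred_sum // => i _; rewrite -mul_polyC rpredM ?rpredX ?polyOverX //.
by rewrite polyOverC floc_tofrac.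
Qed.

Lemma star_over a u : u \is a polyOver O -> star a u \is a polyOver O.
Proof. by move=> hu; apply: polyOver_comp => //; apply: carlitz_over. Qed.

Lemma starM a b (u : KX) : star (a * b) u = star b (star a u).
Proof. by rewrite /star phi_polyM comp_polyA. Qed.

Local Notation d := (size f).-1.
Local Notation q := #|F|.

(** Term by term: $C^i-x^{Qi}$ is a multiple of $C-x^Q$, and $u_i^Q\equiv u_i$ modulo $f$. *)
Lemma f_ideal_comp_frob (C u : KX) Q : [pchar KX].-nat Q ->
  (forall x, x \in O -> (tof f)^-1 * (x ^+ Q - x) \in O) ->
  C \is a polyOver O -> J (C - 'X^Q) -> u \is a polyOver O ->
  J (u \Po C - u ^+ Q).
Proof.
move=> hQ hfermat hC hCX /polyOverP hu.
have -> : u ^+ Q = \sum_(i < size u) (u`_i ^+ Q)%:P * 'X^Q ^+ i.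
  rewrite -[in u ^+ _](coefK u) poly_def -[in LHS](expn1 Q) (frob_sum hQ).
  apply: eq_bigr => i _.
  by rewrite expn1 -mul_polyC exprMn -polyC_exp -!exprM mulnC.
rewrite comp_polyE -sumrB; apply: f_ideal_sum => i _; rewrite -mul_polyC.
have key (x y v w : KX) : x * v - y * w = x * (v - w) - (y - x) * w.
  by rewrite mulrBr mulrBl opprB addrA subrK.
rewrite key -polyCB.
apply: f_idealB.
  apply: f_idealMl; rewrite ?polyOverC ?hu // subrXX.
  apply: f_idealMr => //; apply: rpred_sum => j _.
  by apply: rpredM; rewrite !rpredX ?polyOverX.
apply: f_idealMr; last by rewrite !rpredX ?polyOverX.
by rewrite /f_ideal scale_polyC polyOverC hfermat.
Qed.

Lemma pnat_polyfrac : [pchar KX].-nat q.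
Proof. exact (pnat_rmorph polyC (pnat_rmorph tof (pnat_card_poly F))). Qed.

Lemma star_irred_frob u : u \is a polyOver O -> J (star f u - u ^+ (q ^ d)).
Proof.
apply: f_ideal_comp_frob; first exact: pnat_charX pnat_polyfrac d.
- exact: floc_fermat.
- exact: carlitz_over.
have [w ->] := phi_poly_carlitz hf tof; rewrite addrC addKr.
by apply: f_idealMr; [exact: f_ideal_tofrac | exact: map_poly_over].
Qed.

(** Induction on [l]: with $v$ and $y$ the two sides at stage [l], the next difference is $(f\star
    v-v^{q^d})+(v-y)^{q^d}$. *)
Lemma star_irredX_frob l u : u \is a polyOver O ->
  J (star (f ^+ l) u - u ^+ (q ^ (d * l))).
Proof.
have hX := pnat_polyfrac; move=> hu; elim: l => [|l IHl].
  by rewrite /star phi_poly1 comp_polyXr muln0 expr1 subrr f_ideal0.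
rewrite exprSr starM mulnS addnC expnD exprM.
set v := star (f ^+ l) u in IHl *; set y := u ^+ _ in IHl *.
have frobB (x z : KX) : x ^+ (q ^ d) - z ^+ (q ^ d) = (x - z) ^+ (q ^ d).
  by rewrite (frobD hX) (frobN hX).
rewrite -[star f v](subrK (v ^+ (q ^ d))) -addrA frobB.
apply: f_idealD; first by apply: star_irred_frob; apply: star_over.
by apply: f_idealX; rewrite ?(frob_gt0 hX).
Qed.

End LocalRing.

(** * The exponential series *)

Section Exponential.
Variables (F : finFieldType) (phi : drinfeld F).
Variable alpha : nat -> {fraction {poly F}}.
Hypothesis halpha : is_drinfeld_exp phi alpha.
Local Notation A := {poly F}.
Local Notation K := {fraction A}.
Local Notation tof := (@tofrac A).
Local Notation q := #|F|.
Let hK : [pchar K].-nat q := pnat_rmorph tof (pnat_card_poly F).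

(** The functional equation of $\exp_\phi$, read at the exponents $q^k$, where composition is the
    product of $K\{\{\tau\}\}$. *)
Lemma exp_tser a :
  (alpha : tser hK) * tserC hK (tof a) = tmap tof hK (twist phi a) * alpha.
Proof.
apply: funext => k; have := halpha.2 a (q ^ k)%N.
rewrite /exp_series (ps_frob_expn (card_gt1 F)) tserMC mulrC => ->.
have -> : (fun i => (phi_poly tof phi a)`_i)
    = ps_frob q (tmap tof hK (twist phi a)).
  by apply: funext => i; apply: coef_phi_poly.
by rewrite (ps_comp_frob (hq := hK) (card_gt1 F)) ps_frob_expn ?card_gt1.
Qed.

Variables (f : A) (hf : monic_irreducible_poly f).
Local Notation O := (floc hf).

(* alpha_i (theta^(q^i) - theta) is the sum of the
   kappa_j alpha_(i-j)^(q^j), and f divides theta^(q^i) - theta at most once. *)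
Lemma exp_coef_floc i : tof f ^+ (q ^ i).-1 * alpha i \in O.
Proof.
elim/ltn_ind: i => i IHi.
have [->|i0] := posnP i; first by rewrite expn0 mul1r halpha.1 rpred1.
pose w : A := 'X ^+ (q ^ i) - 'X.
have hw : alpha i * tof w =
    \sum_(j < i) tof phi`_j.+1 * alpha (i - j.+1)%N ^+ (q ^ j.+1).
  have := congr1 (fun u : tser hK => u i) (exp_tser 'X).
  rewrite tserMC twistX tserM big_ord_recl /= subn0 expr1.
  rewrite {1}/dm_tser dm_coef0 => h.
  by rewrite tofracB tofracXn mulrBr h [alpha i * _]mulrC addrAC subrr add0r.
(* Here [v] is the order of [w] at $f$, and [h] is invertible in $A_{(f)}$. *)
have [v [h [v1 hv fh]]] : exists v h, [/\ (v <= 1)%N, w = f ^+ v * h & ~~ (f %| h)].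
  have [/dvdpP[h hh]|fw] := boolP (f %| w); last by exists 0%N, w; rewrite mul1r.
  exists 1%N, h; rewrite expr1 mulrC; split=> //.
  apply: contra (ndvd_frob_sqr hf i0) => /dvdpP[h' hh'].
  by rewrite -/w hh hh' -mulrA -expr2 dvdp_mull.
have f0 := tofrac_f_neq0 hf.
(* The budget of $q^i-1$ factors $f$: [v] of them absorb the division by [w], and $(q^{i-j}-1)q^j$
   make $\alpha_{i-j}^{q^j}$ integral. The rest is $r=q^j-1-v$, nonnegative because $q^j\ge2$ and
   $v\le1$. *)
have hexp j : (0 < j <= i)%N ->
    exists r, (q ^ i).-1 = (v + (r + (q ^ (i - j)).-1 * q ^ j))%N.
  case/andP=> j0 ji; rewrite -{1}(subnK ji) expnD.
  have: (1 < q ^ j)%N by rewrite -(expn0 q) ltn_exp2l ?card_gt1.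
  case: (q ^ j)%N => [|[|n]] // _.
  have: (0 < q ^ (i - j))%N by rewrite expn_gt0 ltnW ?card_gt1.
  case: (q ^ (i - j))%N => // m _; exists (n.+1 - v)%N.
  by rewrite addnA subnKC ?(leq_trans v1) // mulSn.
have key (x y z u : K) : u != 0 -> x * y * z = u^-1 * (y * (z * (x * u))).
  move=> u0; rewrite [x * u]mulrC [z * _]mulrCA [y * _]mulrCA mulKf //.
  by rewrite -mulrA mulrC mulrA.
have [M hM] : exists M, (q ^ i).-1 = (v + M)%N.
  by have [|r ->] := hexp i; [rewrite i0 /= | exists (r + (q ^ (i - i)).-1 * q ^ i)%N].
rewrite hM exprD (key _ _ _ _ (ndvd_tofrac_neq0 fh)) -[tof f ^+ v]tofracXn -tofracM -hv hw.
rewrite rpredM ?floc_tofracV // big_distrr rpred_sum // => j _.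
have [|r hr] := hexp j.+1; first by rewrite /= ltn_ord.
have -> : M = (r + (q ^ (i - j.+1)).-1 * q ^ j.+1)%N.
  by apply/eqP; rewrite -(eqn_add2l v) -hM hr.
rewrite /= mulrCA exprD -mulrA [tof f ^+ (_ * _)]exprM -exprMn.
rewrite rpredM ?floc_tofrac // rpredM ?rpredX ?floc_tofrac //.
by apply: IHi; rewrite ltn_subrL.
Qed.

End Exponential.

(** * Sums over the monic polynomials of a given degree *)

Section MonicSum.
Variables (F : finFieldType) (V : nmodType).
Local Notation A := {poly F}.
Local Notation monic_of_deg j a := (((a : A) \is monic) && (size (a : A) == j.+1)).

Definition monic_sum (j : nat) (G : A -> V) : V :=
  \sum_(a : {poly_(j.+1) F} | monic_of_deg j a) G a.

(** Multiplication by [m] is a bijection from the monic polynomials of degree [j] onto the monic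
    multiples of [m] of degree $\deg m+j$. *)
Lemma monic_sum_mul (m : A) j (G : A -> V) : m \is monic ->
  monic_sum j (fun a => G (m * a)) =
  monic_sum ((size m).-1 + j) (fun c => if m %| c then G c else 0).
Proof.
move=> hm; set e := (size m).-1.
have m0 := monic_neq0 hm.
have sm : size m = e.+1 by rewrite prednK // size_poly_gt0.
rewrite /monic_sum -big_mkcondr /=.
have sz (a : {poly_(j.+1) F}) : (size (m * a)%R <= (e + j).+1)%N.
  rewrite (leq_trans (size_polyMleq _ _)) // sm /= -addnS leq_add2l.
  exact: size_npoly.
rewrite [RHS](reindex_onto (fun a : {poly_(j.+1) F} => npolyp (e + j).+1 (m * a))
  (fun c : {poly_((e + j).+1) F} => npolyp j.+1 (c %/ m))); last first.
  move=> c /andP[/andP[_ /eqP sc] mc]; apply: val_inj; rewrite /=.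
  have sd : (size (c %/ m)%R <= j.+1)%N.
    by rewrite size_divp // sc -/e -addnS addKn.
  by rewrite !npolypK ?(mulrC m) ?divpK ?sc.
apply: eq_big => [a|a _]; last by rewrite npolypK.
rewrite npolypK // dvdp_mulIl andbT monicMl //.
have -> : (npolyp j.+1 ((m * a) %/ m) == a).
  by rewrite -val_eqE /= [m * _]mulrC mulpK // npolypK // size_npoly.
rewrite andbT; case: (boolP ((a : A) \is monic)) => //= ha.
rewrite size_Mmonic ?monic_neq0 // sm addSn /= -[(e + j).+1]addnS eqn_add2l //.
Qed.

Lemma monic_sum_small (m : A) k (G : A -> V) : (k < (size m).-1)%N ->
  monic_sum k (fun c => if m %| c then G c else 0) = 0.
Proof.
move=> km; rewrite /monic_sum big1 // => c /andP[hc /eqP sc].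
case: ifP => // /(dvdp_leq (monic_neq0 hc)); rewrite sc.
by rewrite leqNgt -ltn_predRL km.
Qed.

End MonicSum.

(** * The Euler factor at f *)

Section EulerFactor.
Variables (F : finFieldType) (phi : drinfeld F).
Variables (P : {poly F} -> {poly {poly F}}) (c : {poly F} -> F).
Variables (mu : {poly F} -> {poly F}) (hmu : is_mu phi P c mu).
Variables (f : {poly F}) (hf : monic_irreducible_poly f).
Local Notation A := {poly F}.
Local Notation K := {fraction A}.
Local Notation tof := (@tofrac A).
Local Notation b := (b_coef phi P c f).
Local Notation r := (dm_rank phi).
Local Notation d := (size f).-1.

Lemma coef_R_poly i : (R_poly phi P c f)`_i =
  if i == 0%N then 1 else if (i <= r)%N then - (b i * f ^+ i.-1) else 0.
Proof.
rewrite /R_poly coefB coef1 coef_sum.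
under eq_bigr => l _ do rewrite coefZ coefXn.
case: i => [|i] /=.
  rewrite big_nat big1 ?subr0 // => l /andP[l0 _].
  by rewrite ltn_eqF ?mulr0.
rewrite sub0r; case: ifP => ir; last first.
  rewrite big_nat big1 ?oppr0 // => l /andP[_ lr].
  rewrite gtn_eqF ?mulr0 //; apply: leq_trans lr _.
  by rewrite leqNgt ltnS ir.
rewrite (bigD1_seq i.+1) ?mem_index_iota ?iota_uniq //= eqxx mulr1.
by rewrite big1 ?addr0 // => l /negbTE; rewrite eq_sym => ->; rewrite mulr0.
Qed.

Lemma irred_part a : a != 0 -> exists m a', a = f ^+ m * a' /\ ~~ (f %| a').
Proof.
have [n] := ubnP (size a); elim: n a => // n IHn a an a0.
have [/dvdpP[a' ha]|fa] := boolP (f %| a); last by exists 0%N, a; rewrite mul1r.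
have a'0 : a' != 0 by apply: contra_neq a0 => a'0; rewrite ha a'0 mul0r.
have [] := IHn a' _ a'0.
  rewrite -ltnS (leq_trans _ an) // ltnS ha size_mul ?(irred_neq0 hf) //.
  by rewrite -(prednK (ltnW (irred_gt1 hf))) addnS /= -addn1 leq_add2l deg_irred_gt0.
move=> m [a'' [h ha'']]; exists m.+1, a''; split=> //.
by rewrite ha h mulrC exprS mulrA.
Qed.

(** Write $a=f^ma'$ with $f\nmid a'$. Multiplicativity takes out $f\mu(a')$ and leaves $\sum_i
    R_i\,\mu(f^{m-i})$, with $R_i$ the coefficients of $R_f$, which is 1 if $m=0$ and 0
    otherwise. *)
Lemma euler_factor a : a \is monic ->
  f * mu a - \sum_(1 <= l < r.+1)
    (if f ^+ l %| a then b l * f ^+ l * mu (a %/ f ^+ l) else 0)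
  = if f %| a then 0 else f * mu a.
Proof.
move=> ha; have [m [a' [ea fa']]] := irred_part (monic_neq0 ha).
have fX l : f ^+ l \is monic by rewrite monic_exp ?hf.2.
have ha' : a' \is monic by rewrite -(monicMl _ (fX m)) -ea.
have cop l : coprimep (f ^+ l) a'.
  by rewrite coprimep_expl // (irreducible_poly_coprime _ hf.1).
have muM l : mu (f ^+ l * a') = mu (f ^+ l) * mu a' by case: hmu => _ ->.
have dvdE l : (f ^+ l %| a) = (l <= m)%N.
  rewrite ea Gauss_dvdpl // dvdp_Pexp2l // irred_gt1 //.
have divE l : (l <= m)%N -> a %/ f ^+ l = f ^+ (m - l) * a'.
  move=> lm; rewrite ea -{1}(subnKC lm) exprD -mulrA mulrC mulpK //.
  by rewrite monic_neq0.
transitivity (f * mu a' * \sum_(i < m.+1) (R_poly phi P c f)`_i * mu (f ^+ (m - i))).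
  rewrite big_ord_recl coef_R_poly eqxx mul1r subn0 mulrDr; congr (_ + _).
    by rewrite ea muM mulrAC mulrA.
  rewrite big_distrr /= -sumrN.
  have trunc (H : nat -> A) k n : (k <= n)%N ->
      (forall i, (k <= i)%N -> H i = 0) ->
      \sum_(0 <= i < k) H i = \sum_(0 <= i < n) H i.
    move=> kn H0; rewrite [RHS](big_cat_nat (n := k)) //= [X in _ + X]big_nat.
    by rewrite [X in _ + X]big1 ?addr0 // => i /andP[/H0].
  (* One sum stops at the rank [r], the other at the exponent [m]. The common summand vanishes past
     either bound, so both extend to the maximum. *)
  pose H i := if (i < r)%N && (i < m)%N then
    - (b i.+1 * f ^+ i.+1 * mu (a %/ f ^+ i.+1)) else 0.
  rewrite big_add1 /=; transitivity (\sum_(0 <= i < r) H i).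
    apply: eq_big_nat => i /andP[_ ir]; rewrite /H ir dvdE /=.
    by case: ifP; rewrite ?oppr0.
  rewrite (trunc _ _ (maxn r m)) ?leq_maxl //; last first.
    by move=> i ri; rewrite /H ltnNge ri.
  rewrite -(trunc _ m) ?leq_maxr //; last first.
    by move=> i mi; rewrite /H andbC ltnNge mi.
  rewrite big_mkord; apply: eq_bigr => i _.
  rewrite coef_R_poly /= /H ltn_ord andbT; case: ifP => ir; last first.
    by rewrite mul0r mulr0.
  rewrite divE // muM mulNr mulrN; congr (- _).
  have key (x y z v w : A) : x * (f * y) * (v * w) = f * w * (x * y * v).
    by ring.
  by rewrite exprS key // lift0.
case: hmu => _ _ /(_ f hf m) ->.
rewrite -[f %| a]/(f ^+ 1 %| a) dvdE ea.
by case: m {dvdE divE ea} => [|m]; rewrite ?mulr0 //= mulr1 mul1r.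
Qed.

Local Notation star_mono beta := (fun a => (tof (mu a) / tof a) *: star a beta).

Lemma L_coefE beta j : L_coef mu beta j = monic_sum j (star_mono beta).
Proof. by []. Qed.

(** Applying $f^l\star$ turns $a\star\beta$ into $(f^la)\star\beta$; the sum is then indexed by the
    multiple $f^la$. *)
Lemma star_L_coef beta l j :
  star (f ^+ l) (L_coef mu beta j)
  = monic_sum (d * l + j) (fun a => if f ^+ l %| a then
      (tof (mu (a %/ f ^+ l)) / tof (a %/ f ^+ l)) *: star a beta else 0).
Proof.
have fX : f ^+ l \is monic by rewrite monic_exp ?hf.2.
rewrite -size_exp -monic_sum_mul // /L_coef /star raddf_sum.
apply: eq_bigr => a _ /=; rewrite [f ^+ l * _]mulrC.
by rewrite mulpK ?monic_neq0 // comp_polyZ -comp_polyA -phi_polyM.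
Qed.

Definition L_coprime beta k : {poly K} :=
  monic_sum k (fun a => if f %| a then 0 else star_mono beta a).

Lemma L_coprime_over beta k :
  L_coprime (map_poly tof beta) k \is a polyOver (floc hf).
Proof.
apply: rpred_sum => a _; case: ifP => [_|/negbT fa]; first exact: rpred0.
rewrite -mul_polyC rpredM ?star_over ?map_poly_over // polyOverC.
by rewrite rpredM ?floc_tofrac ?floc_tofracV.
Qed.

(** This is [euler_factor] for each monic $a$ of degree [k], weighted by $(a\star\beta)/a$; the
    factor $f^l$ beside $b_l$ there comes from $1/(a/f^l)=f^l/a$. *)
Lemma euler_L_coef beta k :
  tof f *: L_coef mu beta k - \sum_(1 <= l < r.+1) (tof (b l) *:
    (if (d * l <= k)%N then star (f ^+ l) (L_coef mu beta (k - d * l)) else 0))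
  = tof f *: L_coprime beta k.
Proof.
(* When $dl>k$, no monic polynomial of degree [k] is a multiple of $f^l$, so the right side is 0 as
   well. *)
have hl l : (if (d * l <= k)%N then star (f ^+ l) (L_coef mu beta (k - d * l)) else 0)
  = monic_sum k (fun a => if f ^+ l %| a then
      (tof (mu (a %/ f ^+ l)) / tof (a %/ f ^+ l)) *: star a beta else 0).
  case: leqP => h; first by rewrite star_L_coef subnKC.
  by rewrite monic_sum_small // size_exp.
under eq_bigr => l _ do rewrite hl /monic_sum scaler_sumr.
rewrite exchange_big L_coefE /L_coprime /monic_sum !scaler_sumr -sumrB.
apply: eq_bigr => a /andP[ha _].
have a0 : tof a != 0 by rewrite tofrac_eq0 monic_neq0.
have h l : tof (b l) *: (if f ^+ l %| a then
    (tof (mu (a %/ f ^+ l)) / tof (a %/ f ^+ l)) *: star a beta else 0)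
  = (tof (if f ^+ l %| a then b l * f ^+ l * mu (a %/ f ^+ l) else 0) / tof a)
     *: star a beta.
  case: ifP => fa; last by rewrite rmorph0 mul0r scaler0 scale0r.
  rewrite scalerA; congr (_ *: _).
  have f0 : tof (f ^+ l) != 0 by rewrite tofrac_eq0 expf_neq0 ?(irred_neq0 hf).
  have key (x y v w z : K) : x * v * y * (w * z) = x * (y * w) * (v * z) by ring.
  have ea : tof a = tof (a %/ f ^+ l) * tof (f ^+ l) by rewrite -tofracM divpK.
  by rewrite ea !tofracM invfM key mulfV // mulr1.
under eq_bigr => l _ do rewrite h.
rewrite -scaler_suml -big_distrl /= scalerA mulrA -tofracM -scalerBl -mulrBl.
rewrite -rmorph_sum -rmorphB euler_factor //.
case: ifP => _; first by rewrite rmorph0 mul0r scale0r scaler0.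
by rewrite scalerA mulrA -tofracM.
Qed.

End EulerFactor.

(** * Log-algebraicity *)

Section FrobeniusRelation.
Variables (F : finFieldType) (phi : drinfeld F).
Variables (P : {poly F} -> {poly {poly F}}) (c : {poly F} -> F).
Hypothesis hPc : frob_data phi P c.
Variables (f : {poly F}) (hf : monic_irreducible_poly f).
Local Notation A := {poly F}.
Local Notation qA := (pnat_card_poly F).
Local Notation b := (b_coef phi P c f).
Local Notation r := (dm_rank phi).
Local Notation d := (size f).-1.

(* phi_f - sum_l phi_(b_l) tau^(dl) *)
Definition frob_defect : tser qA :=
  twist phi f - \sum_(1 <= l < r.+1) twist phi (b l) * tserX qA (d * l)%N.

(** The terms with $\tau^{dl}$, $l\ge1$, do not reach $\tau^0$. This coefficient $f$ is the pivot of
    the final induction. *)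
Lemma frob_defect0 : frob_defect 0%N = f.
Proof.
rewrite /frob_defect tserD tserN tser_sum twist_coef0 big_nat big1 ?subr0 //.
move=> l /andP[l0 _]; rewrite tserMX leqNgt muln_gt0 l0 andbT.
by rewrite (deg_irred_gt0 hf).
Qed.

Lemma twistC x : twist phi x%:P = tserC qA x%:P.
Proof. exact: horner_morphC. Qed.

Lemma red_rank_le : (red_rank phi f <= r)%N.
Proof.
by rewrite /red_rank /dm_rank -!subn1 leq_sub2r // /map_poly size_poly.
Qed.

(** In positive reduced rank the defect is $c_f$ times $P_f$ evaluated at $\tau^d$ through [twist],
    which vanishes modulo $f$. *)
Lemma frob_defect_dvd i : f %| frob_defect i.
Proof.
(* In reduced rank 0 all $b_l$ vanish and $\phi_\theta$ reduces to the scalar $\theta$, so $\phi_f$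
   reduces to the scalar $f$, which is 0. *)
have [r0|r0] := posnP (red_rank phi f).
  rewrite /frob_defect big_nat big1 ?subr0 => [|l _]; last first.
    by rewrite /b_coef r0 ltn0 ltnn andbF rmorph0 mul0r.
  have hk : [pchar (residue_closure hf)].-nat #|F| := pnat_rmorph (reduce hf) qA.
  rewrite -(reduce_eq0 hf) -[reduce hf _]/(tmap (reduce hf) hk (twist phi f) i).
  have dmC : tmap (reduce hf) hk (dm_tser phi) = tserC hk (reduce hf 'X).
    apply: funext => -[|n]; first by rewrite /tmap /dm_tser dm_coef0.
    rewrite /tmap /dm_tser /tserC /=; apply/eqP.
    rewrite reduce_eq0 -(to_residue_eq0 hf); apply/eqP.
    transitivity ((map_poly (in_qpoly f) phi)`_n.+1).
      by rewrite coef_map_id0 ?in_qpoly0.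
    by apply: nth_default; move: r0; rewrite /red_rank; case: size => [|[]].
  rewrite twistE rmorph_sum.
  under eq_bigr => j _ do
    rewrite rmorphM rmorphXn /= dmC tmapC -rmorphXn -rmorphM /= -rmorphXn -rmorphM.
  rewrite -!rmorph_sum /=.
  rewrite (_ : \sum_(j < _) _ = f); last first.
    by rewrite -[RHS]coefK poly_def; apply: eq_bigr => j _; rewrite mul_polyC.
  have -> : reduce hf f = 0 by apply/eqP; rewrite reduce_eq0.
  by rewrite rmorph0 tser0.
have [[l [hl [_ hch]]] [c0 P0]] := hPc hf r0.
have [sP lP] := frob_char_poly_size hch.
have := frob_char_poly_twist i r0 hch; rewrite sP.
set u := \sum_(s < _) _ => fu.
suff -> : frob_defect = tserC qA (c f)%:P * u by rewrite tserCM dvdp_mull.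
have tserX0 : tserX qA 0 = 1 by apply: funext => -[|n].
rewrite -twistC /u big_distrr big_ord_recl /= muln0 tserX0.
rewrite /frob_defect; congr (_ + _).
  rewrite mulr1 -rmorphM P0 mul_polyC scalerA mulfV // scale1r //.
(* Indices above the reduced rank carry $b_l=0$; the others match $c_fa_l=-b_l$, the top one because
   [P f] is monic. *)
rewrite -sumrN big_add1 /= (big_cat_nat (n := red_rank phi f)) ?red_rank_le //=.
rewrite [X in _ + X]big_nat [X in _ + X]big1 ?addr0; last first.
  move=> j /andP[rj _]; rewrite /b_coef ltnNge ltnW ?ltnS // gtn_eqF ?ltnS //=.
  by rewrite rmorph0 mul0r oppr0.
rewrite big_mkord; apply: eq_bigr => j _; rewrite /bump leq0n add1n mulrA -rmorphM -mulNr.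
rewrite -rmorphN; congr (twist phi _ * _); rewrite /b_coef.
have [jr|jr] := ltnP j.+1 (red_rank phi f); first by rewrite opprK mul_polyC.
have ej : j.+1 = red_rank phi f by apply/eqP; rewrite eqn_leq jr ltn_ord.
by rewrite ej eqxx r0 lP mulr1 opprK.
Qed.

End FrobeniusRelation.

(** The Euler relation is multiplied by [x] on the left, and [x] is moved across each constant,
    which becomes its twist. Here [x] stands for $\exp_\phi$. *)
Lemma twisted_relation (R : nzRingType) (x u v cf tf : R) (cb tb su X : nat -> R)
    (s : seq nat) :
  x * cf = tf * x -> (forall l, x * cb l = tb l * x) ->
  cf * u - \sum_(l <- s) cb l * (su l * X l) = cf * v ->
  tf * (x * u) - \sum_(l <- s) tb l * (x * su l * X l) = x * cf * v.
Proof.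
move=> hf hb huv; rewrite -[RHS]mulrA -huv mulrBr !mulrA hf; congr (_ - _).
by rewrite big_distrr; apply: eq_bigr => l _; rewrite /= !mulrA hb.
Qed.

(** * Integrality of the coefficients of $\mathcal{E}_\phi$ *)

Section LogAlgebraicity.
Variables (F : finFieldType) (phi : drinfeld F).
Variable alpha : nat -> {fraction {poly F}}.
Hypothesis halpha : is_drinfeld_exp phi alpha.
Variables (P : {poly F} -> {poly {poly F}}) (c : {poly F} -> F).
Hypothesis hPc : frob_data phi P c.
Variables (mu : {poly F} -> {poly F}) (hmu : is_mu phi P c mu).
Variable beta : {poly {poly F}}.
Variables (f : {poly F}) (hf : monic_irreducible_poly f).
Local Notation A := {poly F}.
Local Notation K := {fraction A}.
Local Notation KX := {poly K}.
Local Notation tof := (@tofrac A).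
Local Notation q := #|F|.
Local Notation qA := (pnat_card_poly F).
Local Notation b := (b_coef phi P c f).
Local Notation r := (dm_rank phi).
Local Notation d := (size f).-1.
Local Notation O := (floc hf).
Local Notation J := (f_ideal hf).
Local Notation hX := (pnat_polyfrac F).
Local Notation T := (tser hX).

Definition constX : A -> KX := polyC \o tof.
HB.instance Definition _ := GRing.RMorphism.on constX.
Local Notation twX a := (tmap constX hX (twist phi a)).
Local Notation cst a := (tserC hX (constX a)).

Definition exp_serX : T := fun i => (alpha i)%:P.
Definition L_ser : T := L_coef mu (map_poly tof beta).
Definition E_ser : T := exp_serX * L_ser.
Definition H_ser : T := L_coprime mu f (map_poly tof beta).
Definition star_ser l : T -> T :=
  tmap (comp_poly (phi_poly tof (carlitz F) (f ^+ l))) hX.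
HB.instance Definition _ l := GRing.RMorphism.on (star_ser l).

Lemma E_seriesE n :
  E_series alpha mu (map_poly tof beta) n = ps_frob q E_ser n.
Proof.
apply: etrans (ps_comp_frob (card_gt1 F) exp_serX L_ser n).
congr (ps_comp _ _ _); apply: funext => i.
by rewrite /exp_series /ps_frob rmorph_sum.
Qed.

Lemma exp_serX_commute a : exp_serX * cst a = twX a * exp_serX.
Proof.
have hK := pnat_rmorph tof qA.
have := congr1 (fun u => tmap polyC hX u) (exp_tser halpha a).
by rewrite !rmorphM /= tmapC.
Qed.

Lemma star_ser_exp l : star_ser l exp_serX = exp_serX.
Proof. by apply: funext => i; rewrite /star_ser /tmap /= comp_polyC. Qed.

Lemma euler_ser :
  cst f * L_ser
    - \sum_(1 <= l < r.+1) cst (b l) * (star_ser l L_ser * tserX hX (d * l)%N)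
  = cst f * H_ser.
Proof.
have hC a (u : T) n : (cst a * u) n = tof a *: u n.
  by rewrite -mul_polyC; apply: tserCM.
apply: funext => k; rewrite tserD tserN tser_sum.
apply: etrans (esym (hC f H_ser k)).
apply: etrans (euler_L_coef hmu hf (map_poly tof beta) k).
congr (_ - _); first exact: hC.
apply: eq_bigr => l _; apply: etrans (hC _ _ _) _.
by congr (_ *: _); apply: tserMX.
Qed.

Lemma E_ser_relation :
  twX f * E_ser
    - \sum_(1 <= l < r.+1) twX (b l) * (star_ser l E_ser * tserX hX (d * l)%N)
  = exp_serX * cst f * H_ser.
Proof.
have hstar l : star_ser l E_ser = exp_serX * star_ser l L_ser.
  by rewrite -[in RHS](star_ser_exp l); apply: rmorphM.
under eq_bigr => l _ do rewrite hstar.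
exact: twisted_relation (exp_serX_commute f) (fun l => exp_serX_commute (b l)) euler_ser.
Qed.

(** Moving $f$ across $\tau^i$ gives $f^{q^i}$: one factor puts the term in the ideal, the other
    $q^i-1$ clear the denominator of $\alpha_i$. *)
Lemma E_relation_f_ideal k : J ((exp_serX * cst f * H_ser) k).
Proof.
rewrite tserM; apply: f_ideal_sum => i _; apply: f_idealMr; last first.
  by apply: rpredX; apply: L_coprime_over.
rewrite tserMC /constX /= -polyC_exp -polyCM /f_ideal scale_polyC polyOverC.
have qi : (0 < q ^ i)%N by rewrite expn_gt0 ltnW ?card_gt1.
have := exp_coef_floc halpha hf i; set n := (q ^ i).-1.
rewrite (_ : (q ^ i)%N = n.+1); last by rewrite prednK.
by rewrite exprS mulrCA mulKf ?tofrac_f_neq0 // mulrC.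
Qed.

Lemma E_ser_over k : E_ser k \is a polyOver O.
Proof.
elim/ltn_ind: k => k IHk.
have constX_over a : constX a \is a polyOver O by rewrite polyOverC floc_tofrac.
have frob_pos i : (0 < q ^ i)%N by rewrite expn_gt0 ltnW ?card_gt1.
(* Since $dl>0$, only coefficients of [E_ser] of index below [k] occur, so the induction hypothesis
   gives $\sigma^l\equiv\tau^{dl}$ on them. *)
have hW l m : (0 < l)%N -> (m <= k)%N ->
    J ((star_ser l E_ser * tserX hX (d * l)%N - tserX hX (d * l)%N * E_ser) m).
  move=> l0 mk; rewrite tserD tserN tserMX tserXM.
  case: ifP => dlm; last by rewrite subr0 f_ideal0.
  apply: star_irredX_frob; apply: IHk; apply: leq_trans mk.
  have dl : (0 < d * l)%N by rewrite muln_gt0 l0 (deg_irred_gt0 hf).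
  by rewrite ltn_subrL dl (leq_trans dl dlm).
pose D := frob_defect phi P c f.
(* Replacing each $\sigma^l(E)\tau^{dl}$ by $\tau^{dl}E$ gathers the left side of the relation into
   the defect times $E$. *)
have hD : tmap constX hX D * E_ser = exp_serX * cst f * H_ser
    + \sum_(1 <= l < r.+1) twX (b l) *
      (star_ser l E_ser * tserX hX (d * l)%N - tserX hX (d * l)%N * E_ser).
  rewrite -E_ser_relation; under [X in _ + X]eq_bigr => l _ do rewrite mulrBr.
  rewrite sumrB addrA subrK /D /frob_defect rmorphB mulrBl; congr (_ - _).
  rewrite rmorph_sum big_distrl; apply: eq_bigr => l _ /=.
  by rewrite rmorphM /= tmapX; apply: esym (mulrA _ _ _).
have hDk : J ((tmap constX hX D * E_ser) k).
  rewrite hD tserD; apply: f_idealD; first exact: E_relation_f_ideal.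
  rewrite tser_sum big_nat; apply: f_ideal_sum => l /andP[l0 _].
  rewrite tserM; apply: f_ideal_sum => i _; apply: f_idealMl.
    exact: constX_over.
  by apply: f_idealX; rewrite ?frob_pos // hW // leq_subr.
apply: (f_ideal_mulf (hf := hf)).
have D0 : D 0%N = f by apply: frob_defect0.
(* The coefficient of $\tau^k$ is $fE_k$ plus terms $D_jE_{k-j}^{q^j}$ with $j\ge1$, which lie in
   the ideal because $f$ divides $D_j$ and $E_{k-j}$ is already integral. *)
move: hDk; rewrite tserM big_ord_recl subn0 expr1 {1}/tmap D0.
set S := \sum_(i < k) _ => hS.
have JS : J S.
  apply: f_ideal_sum => i _; apply: f_idealMr.
    exact/f_ideal_tofrac/frob_defect_dvd.
  by apply: rpredX; apply: IHk; rewrite ltn_subrL /= (leq_trans _ (ltn_ord i)).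
by have := f_idealB hS JS; rewrite addrK.
Qed.

End LogAlgebraicity.

Theorem theorem5p1 (F : finFieldType) (phi : drinfeld F)
    (alpha : nat -> {fraction {poly F}}) (halpha : is_drinfeld_exp phi alpha)
    (P : {poly F} -> {poly {poly F}}) (c : {poly F} -> F)
    (hPc : frob_data phi P c)
    (mu : {poly F} -> {poly F}) (hmu : is_mu phi P c mu)
    (beta : {poly {poly F}})
    (f : {poly F}) (hf : monic_irreducible_poly f) :
  forall n : nat,
    E_series alpha mu (map_poly (@tofrac _) beta) n \is a polyOver (loc_ring f).
Proof.
move=> n; rewrite E_seriesE.
have: ps_frob #|F| (E_ser alpha mu beta) n \is a polyOver (floc hf).
  by apply: rpred_sum => i _; apply: (E_ser_over halpha hPc hmu beta hf).
by apply: polyOverS => x; apply: floc_loc_ring.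
Qed.
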